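(* As $n\to\infty$ we have (i) $f(K_n,P_6,4)=\frac14 n^2+O(n)$, (ii) $f(K_n,P_7,5)=\frac12 n^2+O(n)$, and (iii) $f_{\text{proper}}(K_n, P_8, 5) = \frac{7}{30}n^2 +O(n)$.
   Context: $K_n$ is the complete graph on $n$ vertices and $P_k$ is the path on $k$ vertices. For graphs $G,H$ and a positive integer $q$, an $(H,q)$-coloring of $G$ is an edge-coloring of $G$ (not necessarily proper) in which every copy of $H$ in $G$ (as a not necessarily induced subgraph) receives at least $q$ different colors on its edges. $f(G,H,q)$ denotes the minimum number of colors needed for an $(H,q)$-coloring of $G$. $f_{\text{proper}}(K_n,P_8,5)$ denotes the minimum number of colors needed in a $(P_8,5)$-coloring of $K_n$ that is also a proper edge-coloring (adjacent edges receive different colors). *)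

(* Defs.v *)
From mathcomp Require Import all_boot.

Set Implicit Arguments.
Unset Strict Implicit.
Unset Printing Implicit Defensive.

Record sgraph := SGraph {
  vertex :> finType;
  adj : rel vertex;
  adj_sym : symmetric adj;
  adj_irrefl : irreflexive adj
}.

Definition edges (G : sgraph) : {set {set G}} :=
  [set [set x; y] | x in G, y in G & adj x y].

Definition edge (G : sgraph) : finType := {e : {set G} | e \in edges G}.

Definition complete_adj n : rel 'I_n := fun i j => i != j.

Lemma complete_adj_sym n : symmetric (@complete_adj n).
Proof. by move=> i j; rewrite /complete_adj eq_sym. Qed.

Lemma complete_adj_irrefl n : irreflexive (@complete_adj n).
Proof. by move=> i; rewrite /complete_adj eqxx. Qed.

Definition complete_graph (n : nat) : sgraph :=
  SGraph (@complete_adj_sym n) (@complete_adj_irrefl n).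

Definition path_adj k : rel 'I_k := fun i j => (i.+1 == j) || (j.+1 == i).

Lemma path_adj_sym k : symmetric (@path_adj k).
Proof. by move=> i j; rewrite /path_adj orbC. Qed.

Lemma path_adj_irrefl k : irreflexive (@path_adj k).
Proof. by move=> i; rewrite /path_adj orbb gtn_eqF. Qed.

Definition path_graph (k : nat) : sgraph :=
  SGraph (@path_adj_sym k) (@path_adj_irrefl k).

Definition coloring (G : sgraph) (k : nat) := {ffun edge G -> 'I_k}.

(* A copy of H in G is given by an embedding of H into G, i.e., an injective
   map of vertices preserving (but not necessarily reflecting) adjacency. *)
Definition embedding (H G : sgraph) (phi : {ffun H -> G}) : bool :=
  injectiveb phi && [forall x, forall y, adj x y ==> adj (phi x) (phi y)].

Definition copy_edges (H G : sgraph) (phi : {ffun H -> G}) : {set {set G}} :=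
  [set phi @: (e : {set H}) | e in edges H].

Definition colors_on (G : sgraph) k (c : coloring G k) (F : {set {set G}}) :
  {set 'I_k} := [set c e | e : edge G & val e \in F].

Definition Hq_coloring (H : sgraph) (q : nat) (G : sgraph) k
    (c : coloring G k) : bool :=
  [forall phi : {ffun H -> G},
     embedding phi ==> (q <= #|colors_on c (copy_edges phi)|)].

Definition proper_coloring (G : sgraph) k (c : coloring G k) : bool :=
  [forall e1 : edge G, forall e2 : edge G,
     (e1 != e2) && (val e1 :&: val e2 != set0) ==> (c e1 != c e2)].

(* The minimum k for which some coloring with palette 'I_k satisfies P.
   Only k <= #|edges G| are considered; by min_colorsP this is the true minimum
   as soon as some coloring with #|edges G| colors satisfies P, and for ramsey_f
   and ramsey_f_proper this holds whenever q <= #|edges H|: see ramsey_fP and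
   ramsey_f_properP. *)
Definition min_colors (G : sgraph) (P : forall k, pred (coloring G k)) : nat :=
  \big[minn/#|edges G|]_(k < #|edges G| | [exists c : coloring G k, P k c]) k.

Definition ramsey_f (G H : sgraph) (q : nat) : nat :=
  min_colors (fun k (c : coloring G k) => Hq_coloring H q c).

Definition ramsey_f_proper (G H : sgraph) (q : nat) : nat :=
  min_colors
    (fun k (c : coloring G k) => proper_coloring c && Hq_coloring H q c).

Lemma min_colorsP (G : sgraph) (P : forall k, pred (coloring G k)) :
  (exists c : coloring G #|edges G|, P _ c) ->
  (exists c : coloring G (min_colors P), P _ c) /\
  (forall k (c : coloring G k), P k c -> min_colors P <= k).
Proof.
move=> exP; split; rewrite /min_colors.
  apply: (big_ind (fun m => exists c : coloring G m, P m c)) => //.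
    by move=> x y Px Py; rewrite /minn; case: ifP.
  by move=> k /existsP.
move=> k c Pc; case: (ltnP k #|edges G|) => [ltk|lek].
  have : Ordinal ltk \in index_enum 'I_#|edges G| by rewrite mem_index_enum.
  elim: (index_enum _) => // j s IHs; rewrite inE big_cons.
  case/predU1P=> [<-|/IHs le_k] /=; last first.
    by case: ifP => // _; rewrite geq_min le_k orbT.
  have -> : [exists c : coloring G k, P k c] by apply/existsP; exists c.
  exact: geq_minl.
apply: leq_trans lek; elim/big_rec: _ => // i m _ le_m.
by rewrite geq_min le_m orbT.
Qed.

Lemma card_copy_edges (H G : sgraph) (phi : {ffun H -> G}) :
  embedding phi ->
  copy_edges phi \subset edges G /\ #|copy_edges phi| = #|edges H|.
Proof.
case/andP=> /injectiveP phi_inj /forallP phi_adj; split.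
  apply/subsetP=> _ /imsetP[_ /imset2P[x y _ /[!inE] /andP[_ xy] ->] ->].
  rewrite imsetU1 imset_set1; apply/imset2P; exists (phi x) (phi y) => //.
  by rewrite inE /= (implyP (forallP (phi_adj x) y)).
exact/card_imset/imset_inj.
Qed.

Lemma rainbow_coloring (G : sgraph) :
  exists c : coloring G #|edges G|, injective c.
Proof.
have cardE : #|edge G| = #|edges G| by rewrite card_sig.
exists [ffun e => cast_ord cardE (enum_rank e)] => e1 e2.
by rewrite !ffunE => /cast_ord_inj /enum_rank_inj.
Qed.

Lemma rainbow_proper (G : sgraph) k (c : coloring G k) :
  injective c -> proper_coloring c.
Proof.
move=> c_inj; apply/forallP=> e1; apply/forallP=> e2; apply/implyP.
by case/andP=> ne _; rewrite (inj_eq c_inj).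
Qed.

Lemma rainbow_Hq (G H : sgraph) q k (c : coloring G k) :
  q <= #|edges H| -> injective c -> Hq_coloring H q c.
Proof.
move=> le_q c_inj; apply/forallP=> phi; apply/implyP=> /card_copy_edges[sub eqc].
apply: leq_trans le_q _; rewrite -eqc /colors_on (card_imset _ c_inj).
rewrite -(card_imset _ (@val_inj _ _ (edge G))); apply: subset_leq_card; apply/subsetP=> e eF.
apply/imsetP; exists (Sub e (subsetP sub e eF) : edge G); rewrite ?SubK //.
by rewrite inE SubK.
Qed.

Lemma ramsey_fP (G H : sgraph) q : q <= #|edges H| ->
  (exists c : coloring G (ramsey_f G H q), Hq_coloring H q c) /\
  (forall k (c : coloring G k), Hq_coloring H q c -> ramsey_f G H q <= k).
Proof.
move=> le_q; apply: (min_colorsP (P := fun k => @Hq_coloring H q G k)).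
have [c c_inj] := rainbow_coloring G.
by exists c; apply: rainbow_Hq.
Qed.

Lemma ramsey_f_properP (G H : sgraph) q : q <= #|edges H| ->
  (exists c : coloring G (ramsey_f_proper G H q),
     proper_coloring c && Hq_coloring H q c) /\
  (forall k (c : coloring G k), proper_coloring c && Hq_coloring H q c ->
     ramsey_f_proper G H q <= k).
Proof.
move=> le_q; apply: (min_colorsP
  (P := fun k c => @proper_coloring G k c && @Hq_coloring H q G k c)).
have [c c_inj] := rainbow_coloring G.
by exists c; rewrite rainbow_proper // rainbow_Hq.
Qed.

Lemma card_edges_path k : #|edges (path_graph k.+1)| = k.
Proof.
pose h (i : 'I_k) : {set 'I_k.+1} := [set widen_ord (leqnSn k) i; lift ord0 i].
have -> : edges (path_graph k.+1) = h @: [set: 'I_k].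
  apply/setP=> e; apply/imset2P/imsetP=> [[x y _ /[!inE] /= xy ->]|[i _ ->]].
    case/orP: xy => /eqP xy.
      have ltxk : x < k by rewrite -ltnS xy ltn_ord.
      exists (Ordinal ltxk); rewrite ?inE //; apply/setP=> z.
      by rewrite /h !inE -!val_eqE /= -xy.
    have ltyk : y < k by rewrite -ltnS xy ltn_ord.
    exists (Ordinal ltyk); rewrite ?inE //; apply/setP=> z.
    by rewrite /h !inE orbC -!val_eqE /= -xy.
  exists (widen_ord (leqnSn k) i) (lift ord0 i); rewrite ?inE //=.
  by rewrite /path_adj /= eqxx.
rewrite card_imset ?cardsT ?card_ord // => i j /setP eq_h.
have := eq_h (lift ord0 i); have := eq_h (widen_ord (leqnSn k) i).
rewrite /h !inE !eqxx !orbT /= -!val_eqE /= /bump /= !add1n eqSS.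
case/esym/orP=> [/eqP eq_ij _|/eqP ij]; first exact: val_inj.
by rewrite ij !gtn_eqF.
Qed.

(* Main.v *)
Require Import Defs.
From mathcomp Require Import all_classical reals topology normedtype landau.
From mathcomp Require Import all_boot all_order all_algebra.
From mathcomp Require Import zify lra.

Import numFieldNormedType.Exports.

Set Implicit Arguments.
Unset Strict Implicit.
Unset Printing Implicit Defensive.

(** A path with [k] vertices receives at least [q] colors exactly when at most
    [k - 1 - q] of its edges repeat the color of an earlier edge: one repeat is
    allowed in (i) and (ii), two in (iii).

    Lower bounds. A few edges that form a linear forest on at most [k] vertices
    lie on a common path with [k] vertices, so they cannot repeat colors too
    often.

    For (i) and (ii), two disjoint monochromatic cherries (paths with two edges)
    are excluded. Hence any two cherries meet, and only [O(n)] edges lie in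
    cherries ([card_cherry_edges]). The other edges of a color are pairwise
    disjoint, and there are at most two of them, because three disjoint edges of
    one color lie on a path with six vertices. This gives (i). On paths with
    seven vertices, moreover, two pairs of disjoint edges of equal color that
    share a vertex must lie on the same four vertices ([twin_neighbor]). So the
    edges of these pairs form a graph of maximum degree three, and all but
    [O(n)] edges have pairwise distinct colors, which gives (ii).

    For (iii), each color class is a matching with at most three edges. The
    vertex sets of two classes with three edges have at most one vertex in common
    ([big_supports_meet]), so the fifteen edges on such a vertex set belong to
    only one class: among [E] edges there are at most [E / 15] of these classes.
    The number of colors is thus at least [(E - E / 15) / 2], which is
    [7 / 15 * E].

    Upper bounds. For (ii) all edges get different colors. For (i) and (iii),
    edge-disjoint copies of [K_4], respectively [K_6], cover all but [O(n)] edges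
    ([linear_leave]). Each copy of [K_4] is properly colored with three private
    colors, and the fifteen edges of each copy of [K_6] get seven private colors,
    one used three times and six used twice; every uncovered edge gets its own
    color. A path then repeats colors only inside copies ([repeats_trace]). Two
    copies share at most one vertex, so a path with six or eight vertices has no
    room to collect one repeat more than allowed.

    The cliques are packed by recursion on [n = k * m + t], with [t] bounded and
    [m = 1] modulo [(k - 1)!]: the points are [k] groups of [m] points and [t]
    extra points. The lines [a |-> x + a * y] modulo [m] form blocks that cover
    every pair of points from different groups once, and each group is packed
    recursively together with the extra points. Only the boundedly many blocks
    that contain two extra points have to be dropped, so the number [e] of
    uncovered pairs satisfies [e (k * m + t) <= k * e (m + t) + O(1)] and is
    linear. *)

(** * Colors along a sequence of vertices *)

(** The number of colors that a path saves, compared with a rainbow path. *)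
Fixpoint repeats (T : eqType) (s : seq T) : nat :=
  if s is x :: s' then (x \in s') + repeats s' else 0.

Definition path_colors (V T : Type) (f : V -> V -> T) (s : seq V) : seq T :=
  if s is x :: s' then pairmap f x s' else [::].

Lemma size_undup_repeats (T : eqType) (s : seq T) :
  size (undup s) + repeats s = size s.
Proof. by elim: s => //= x s IHs; case: (x \in s) => /=; lia. Qed.

Lemma repeats_cat (T : eqType) (s1 s2 : seq T) :
  repeats s1 <= repeats (s1 ++ s2).
Proof.
elim: s1 => //= x s1 IHs; apply: leq_add => //.
by rewrite mem_cat; case: (x \in s1).
Qed.

Lemma repeats_map (S T : eqType) (h : S -> T) (s : seq S) :
  {in s &, injective h} -> repeats (map h s) = repeats s.
Proof.
elim: s => //= x s IHs h_inj; rewrite IHs => [|y z ys zs].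
  congr (nat_of_bool _ + _); apply/mapP/idP=> [[y ys]|xs]; last by exists x.
  by move/h_inj=> -> //; rewrite !inE ?eqxx ?ys ?orbT.
by apply: h_inj; rewrite inE ?ys ?zs orbT.
Qed.

Section PathColors.

Variables (V T : eqType) (f : V -> V -> T).

Lemma size_path_colors s : size (path_colors f s) = (size s).-1.
Proof. by case: s => //= x s; rewrite size_pairmap. Qed.

Lemma path_colors_cat s1 s2 :
  exists s, path_colors f (s1 ++ s2) = path_colors f s1 ++ s.
Proof.
case: s1 => [|x s1] /=; first by exists (path_colors f s2).
by rewrite pairmap_cat; exists (pairmap f (last x s1) s2).
Qed.

Lemma mem_path_colors_mid s1 s2 x y :
  f x y \in path_colors f (s1 ++ x :: y :: s2).
Proof.
case: s1 => [|z s1] /=; first by rewrite mem_head.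
by rewrite pairmap_cat mem_cat /= !inE eqxx !orbT.
Qed.

Lemma path_colorsP c s :
  reflect (exists s1 s2 x y, s = s1 ++ x :: y :: s2 /\ c = f x y)
          (c \in path_colors f s).
Proof.
apply: (iffP idP) => [|[s1 [s2 [x [y [-> ->]]]]]]; last exact: mem_path_colors_mid.
case: s => // x s; elim: s x => //= y s IHs x.
rewrite inE => /predU1P[->|/IHs[s1 [s2 [x' [y' [-> ->]]]]]].
  by exists [::], s, x, y.
by exists (x :: s1), s2, x', y'.
Qed.

End PathColors.

Lemma uniq_extend (V : finType) (s : seq V) k :
  uniq s -> size s <= k <= #|V| -> exists s', uniq (s ++ s') /\ size (s ++ s') = k.
Proof.
move=> s_uniq /andP[le_k k_le].
have szC : size (enum [predC s]) = #|V| - size s.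
  by rewrite -cardE -(cardC [in s]) (card_uniqP s_uniq) addKn.
exists (take (k - size s) (enum [predC s])); rewrite cat_uniq s_uniq size_cat.
rewrite take_uniq ?enum_uniq // size_takel ?szC; last by lia.
split; last by lia.
rewrite andbT; apply/hasPn=> x /mem_take; by rewrite mem_enum.
Qed.

(** * Colorings of complete graphs as symmetric functions *)

Section FromColoring.

Variables (n m : nat) (c : coloring (complete_graph n) m).

(** The value [None] is taken on the diagonal only; allowing it costs one
    extra color and removes the case distinction between loops and edges. *)
Definition pair_color (x y : 'I_n) : option 'I_m :=
  omap c (insub ([set x; y] : {set complete_graph n})).

Lemma pair_colorC x y : pair_color x y = pair_color y x.
Proof. by rewrite /pair_color setUC. Qed.

Lemma mem_edges_complete (x y : complete_graph n) :
  x != y -> [set x; y] \in edges (complete_graph n).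
Proof. by move=> xy; apply/imset2P; exists x y; rewrite ?inE. Qed.

Lemma pair_colorE (e : edge (complete_graph n)) (x y : 'I_n) :
  val e = [set x; y] -> pair_color x y = Some (c e).
Proof. by rewrite /pair_color => <-; rewrite valK. Qed.

(** Shorter paths extend to paths with [k.+1] vertices, and the extension
    can only add repeats. *)
Lemma Hq_coloring_repeats k q s :
  Hq_coloring (path_graph k.+1) q c -> k < n -> uniq s -> size s <= k.+1 ->
  q + repeats (path_colors pair_color s) <= k.
Proof.
move=> /forallP Hc lt_kn s_uniq le_sk.
have [|s' [t_uniq sz_t]] := @uniq_extend _ s k.+1 s_uniq.
  by rewrite card_ord le_sk.
set t := s ++ s' in t_uniq sz_t.
have [u pcE] := path_colors_cat pair_color s s'.
have {pcE}: repeats (path_colors pair_color s) <= repeats (path_colors pair_color t).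
  by rewrite pcE repeats_cat.
move=> le_rep; apply: leq_trans (leq_add (leqnn q) le_rep) _.
have x0 : 'I_n by case: (t) sz_t.
pose phi : {ffun path_graph k.+1 -> complete_graph n} := [ffun i : 'I_k.+1 => nth x0 t i].
have phi_emb : embedding phi.
  have phi_inj : injective phi.
    move=> i j; rewrite !ffunE => /eqP.
    by rewrite nth_uniq ?sz_t ?ltn_ord // => /eqP/val_inj.
  apply/andP; split; first exact/injectiveP.
  apply/forallP=> i; apply/forallP=> j; apply/implyP=> ij.
  rewrite /= /complete_adj (inj_eq phi_inj).
  by apply: contraTneq ij => ->; rewrite adj_irrefl.
have szpc := size_path_colors pair_color t; rewrite sz_t /= in szpc.
rewrite -[leqRHS]szpc -size_undup_repeats leq_add2r.
apply: leq_trans (implyP (Hc phi) phi_emb) _.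
rewrite -(card_imset _ (@Some_inj _)) -(card_uniqP (undup_uniq _)).
apply/subset_leq_card/subsetP=> _ /imsetP[_ /imsetP[e /[!inE] e_phi ->] ->].
rewrite mem_undup; case/imsetP: e_phi => _ /imset2P[i j _ /[!inE] /= ij ->].
rewrite imsetU1 imset_set1 !ffunE => eE.
wlog ij1 : i j ij eE / i.+1 = j.
  move=> wl; case/orP: (ij) => /eqP; first exact: wl.
  by apply: wl; rewrite 1?path_adj_sym // eE setUC.
rewrite -(pair_colorE eE).
have lt_j : i.+1 < size t by rewrite sz_t ij1.
apply/path_colorsP.
exists (take i t), (drop i.+2 t), (nth x0 t i), (nth x0 t j); split=> //.
by rewrite -ij1 -!drop_nth ?cat_take_drop // ltnW.
Qed.

Lemma proper_pair_color x y z :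
  proper_coloring c -> x != y -> x != z -> pair_color x y = pair_color x z -> y = z.
Proof.
move=> /forallP c_prop xy xz; have [//|yz] := eqVneq y z.
pose e1 : edge (complete_graph n) := exist _ [set x; y] (mem_edges_complete xy).
pose e2 : edge (complete_graph n) := exist _ [set x; z] (mem_edges_complete xz).
rewrite (@pair_colorE e1) // (@pair_colorE e2) // => -[ce].
have := forallP (c_prop e1) e2; rewrite ce eqxx implybF negb_and !negbK.
case/orP=> [/eqP/(congr1 val)|/eqP/setP/(_ x)]; last by rewrite !SubK !inE eqxx.
rewrite !SubK => /setP/(_ y); rewrite !inE eqxx orbT => /esym/orP[]/eqP // yx.
by move: (xy); rewrite yx eqxx.
Qed.

End FromColoring.

Section ToColoring.

Variables (n : nat) (T : finType) (f : 'I_n -> 'I_n -> T) (S : {set T}).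
Hypotheses (fC : forall x y, f x y = f y x)
           (fS : forall x y, x != y -> f x y \in S).

Lemma coloring_of_pairs :
  exists c : coloring (complete_graph n) #|S|,
    forall (e : edge (complete_graph n)) x y,
      val e = [set x; y] -> enum_val (c e) = f x y.
Proof.
pose good (e : {set 'I_n}) (i : 'I_#|S|) :=
  [forall x, forall y, (e == [set x; y]) ==> (enum_val i == f x y)].
have pickE (e : edge (complete_graph n)) : {i : 'I_#|S| | good (val e) i}.
  case: e => e e_edge /=; apply/sigW; case/imset2P: e_edge => x y _.
  rewrite inE /= => xy ->; exists (enum_rank_in (fS xy) (f x y)).
  apply/forallP=> x'; apply/forallP=> y'; apply/implyP=> /eqP eqxy.
  rewrite enum_rankK_in ?fS //; apply/eqP.
  move/setP: eqxy => eqxy; have := eqxy x; have := eqxy y; rewrite !inE !eqxx orbT /=.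
  move=> /esym/orP[]/eqP yE /esym/orP[]/eqP xE; rewrite ?xE ?yE //.
  - by move: xy; rewrite /complete_adj xE yE eqxx.
  - by move: xy; rewrite /complete_adj xE yE eqxx.
exists [ffun e => sval (pickE e)] => e x y eE; rewrite ffunE; apply/eqP.
by have /forallP/(_ x)/forallP/(_ y)/implyP := svalP (pickE e); apply; rewrite eE.
Qed.

Variable c : coloring (complete_graph n) #|S|.
Hypothesis cE : forall (e : edge (complete_graph n)) x y,
  val e = [set x; y] -> enum_val (c e) = f x y.

Lemma Hq_coloring_of_pairs k q :
  (forall s, uniq s -> size s = k.+1 -> q + repeats (path_colors f s) <= k) ->
  Hq_coloring (path_graph k.+1) q c.
Proof.
move=> Hf; apply/forallP=> phi; apply/implyP=> /andP[/injectiveP phi_inj _].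
pose t : seq 'I_n := codom phi.
have sz_t : size t = k.+1 by rewrite size_codom card_ord.
have t_uniq : uniq t by apply/injectiveP.
have x0 : 'I_n by case: (t) sz_t.
have nth_t i (lt_i : i < k.+1) : nth x0 t i = phi (Ordinal lt_i).
  rewrite /t /codom /image_mem (nth_map (Ordinal lt_i)) ?size_enum_ord //.
  by congr (phi _); apply: val_inj; rewrite /= nth_enum_ord.
have := Hf _ t_uniq sz_t; have := size_undup_repeats (path_colors f t).
rewrite size_path_colors sz_t /= => szE le_q.
rewrite -[leqRHS]szE leq_add2r in le_q; apply: leq_trans le_q _.
rewrite -(card_uniqP (undup_uniq _)).
rewrite -(card_imset _ enum_val_inj); apply/subset_leq_card/subsetP=> a.
rewrite mem_undup => /path_colorsP[s1 [s2 [x [y [tE ->]]]]].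
have lt1 : (size s1).+1 < k.+1 by rewrite -sz_t tE size_cat /=; lia.
have xE := nth_t (size s1) (ltnW lt1); have yE := nth_t _ lt1.
rewrite tE nth_cat ltnn subnn /= in xE.
rewrite tE nth_cat ltnNge leqnSn subSnn /= in yE.
have xy : x != y.
  move: t_uniq; rewrite tE cat_uniq => /and3P[_ _].
  by rewrite /= inE negb_or => /andP[/andP[]].
pose e : edge (complete_graph n) := exist _ [set x; y] (mem_edges_complete xy).
have eE : val e = [set x; y] by [].
have e_phi : val e \in copy_edges phi.
  have -> : val e = phi @: [set Ordinal (ltnW lt1); Ordinal lt1].
    by rewrite eE imsetU1 imset_set1 -xE -yE.
  apply/imset_f/imset2P.
  by eexists; [| |reflexivity]; rewrite ?inE //= /path_adj /= eqxx.
by rewrite -(cE eE); apply/imset_f/imset_f; rewrite inE.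
Qed.

Lemma proper_coloring_of_pairs :
  (forall x y z, x != y -> x != z -> f x y = f x z -> y = z) ->
  proper_coloring c.
Proof.
move=> f_proper; apply/forallP=> e1; apply/forallP=> e2; apply/implyP.
case/andP=> ne /set0Pn[x /setIP[x1 x2]].
have edgeP (e : edge (complete_graph n)) : x \in val e ->
    exists2 y, val e = [set x; y] & x != y.
  case: e => e /= /imset2P[y z _ /[!inE] /= yz ->] /[!inE] /orP[]/eqP->.
    by exists z.
  by exists y; rewrite 1?eq_sym // setUC.
have [[y1 E1 xy1] [y2 E2 xy2]] := (edgeP _ x1, edgeP _ x2).
apply: contra ne => /eqP ec; apply/eqP/val_inj; rewrite E1 E2.
congr [set _; _]; apply: f_proper xy1 xy2 _.
by rewrite -(cE E1) -(cE E2) ec.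
Qed.

End ToColoring.

(** * The Ramsey functions in terms of colors of pairs *)

Section RamseyBounds.

Variables (n k q : nat).
Hypothesis le_qk : q <= k.

Let le_q : q <= #|edges (path_graph k.+1)|.
Proof. by rewrite card_edges_path. Qed.

Lemma ramsey_f_le (T : finType) (f : 'I_n -> 'I_n -> T) (S : {set T}) :
    (forall x y, f x y = f y x) -> (forall x y, x != y -> f x y \in S) ->
    (forall s, uniq s -> size s = k.+1 -> q + repeats (path_colors f s) <= k) ->
  ramsey_f (complete_graph n) (path_graph k.+1) q <= #|S|.
Proof.
move=> fC fS Hf; have [c cE] := coloring_of_pairs fC fS.
have [_ /(_ _ c)] := ramsey_fP (complete_graph n) le_q; apply.
exact: Hq_coloring_of_pairs cE _ _ Hf.
Qed.

Lemma ramsey_f_proper_le (T : finType) (f : 'I_n -> 'I_n -> T) (S : {set T}) :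
    (forall x y, f x y = f y x) -> (forall x y, x != y -> f x y \in S) ->
    (forall x y z, x != y -> x != z -> f x y = f x z -> y = z) ->
    (forall s, uniq s -> size s = k.+1 -> q + repeats (path_colors f s) <= k) ->
  ramsey_f_proper (complete_graph n) (path_graph k.+1) q <= #|S|.
Proof.
move=> fC fS f_proper Hf; have [c cE] := coloring_of_pairs fC fS.
have [_ /(_ _ c)] := ramsey_f_properP (complete_graph n) le_q; apply.
by rewrite (proper_coloring_of_pairs cE f_proper) (Hq_coloring_of_pairs cE Hf).
Qed.

Hypothesis lt_kn : k < n.

Lemma ramsey_f_attained :
  exists f : 'I_n -> 'I_n -> option 'I_(ramsey_f (complete_graph n) (path_graph k.+1) q),
    (forall x y, f x y = f y x) /\
    (forall s, uniq s -> size s <= k.+1 -> q + repeats (path_colors f s) <= k).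
Proof.
have [[c Hc] _] := ramsey_fP (complete_graph n) le_q.
exists (pair_color c); split; first exact: pair_colorC.
by move=> s; apply: Hq_coloring_repeats.
Qed.

Lemma ramsey_f_proper_attained :
  exists f : 'I_n -> 'I_n -> option 'I_(ramsey_f_proper (complete_graph n) (path_graph k.+1) q),
    [/\ (forall x y, f x y = f y x),
        (forall x y z, x != y -> x != z -> f x y = f x z -> y = z) &
        (forall s, uniq s -> size s <= k.+1 -> q + repeats (path_colors f s) <= k)].
Proof.
have [[c /andP[c_prop Hc]] _] := ramsey_f_properP (complete_graph n) le_q.
exists (pair_color c); split; first exact: pair_colorC.
  by move=> x y z; apply: proper_pair_color.
by move=> s; apply: Hq_coloring_repeats.
Qed.

End RamseyBounds.

(** * Counting ordered pairs of vertices *)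

Ltac split_uniq H :=
  rewrite /= ?inE ?negb_or -?andbA in H;
  repeat (let H' := fresh "ne" in case/andP: H => H' H).

(** Solves [uniq s] when the disequalities between the entries of [s] are in
    the context, in either direction. *)
Ltac solve_uniq :=
  rewrite /= ?inE ?negb_or -?andbA;
  repeat (apply/andP; split); first [done | by rewrite eq_sym].

Lemma leq_cardsU (U : finType) (A B : {set U}) : #|A :|: B| <= #|A| + #|B|.
Proof. exact: (leq_card_setU A B).1. Qed.

Lemma ltn_add1 m n : m < n -> m.+1 < 1 + n.
Proof. by []. Qed.

(** Proves a lower bound on the number of repeats of an explicit path, once
    its known colors have been rewritten to normal form; memberships that are
    not decided yet are dropped. *)
Ltac count_repeats :=
  rewrite !eqxx ?orbT /=; repeat first [by [] | apply: ltn_add1 | apply: ltn_addl].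

(** Refutes the current case by the path [s], which shows too many repeats by
    the equations [colE], against the hypothesis [bad]. *)
Ltac clash bad colE s :=
  suff: false by []; apply: (bad s); [by solve_uniq | by [] |
    rewrite /= !inE ?colE; count_repeats].

Section Pairs.

Variable V : finType.

Definition offdiag (K : {set V}) : {set V * V} :=
  [set p | [&& p.1 != p.2, p.1 \in K & p.2 \in K]].

Lemma card_offdiag K : #|offdiag K| = #|K| * #|K|.-1.
Proof.
have : #|setX K K| = #|offdiag K| + #|K|.
  rewrite -(cardsID [set p | p.1 != p.2]); congr (_ + _).
    by apply: eq_card=> -[x y]; rewrite !inE /= andbC.
  rewrite -(@card_imset _ _ (fun x : V => (x, x)) (mem K)); last by move=> x y [].
  apply: eq_card=> -[x y]; rewrite !inE /= negbK.
  apply/and3P/imsetP=> [[/eqP<- xK _]|[z zK [-> ->]]]; first by exists x.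
  by rewrite eqxx.
by rewrite cardsX; case: #|K| => [|k]; lia.
Qed.

Lemma card_fibers (T U : finType) (A : {set U}) (g : U -> T) :
  #|A| = \sum_(i : T) #|[set p in A | g p == i]|.
Proof.
rewrite -sum1_card (partition_big g xpredT) //=; apply: eq_bigr => i _.
by rewrite sum1dep_card; apply: eq_card => p; rewrite !inE.
Qed.

(** A matching, given by the ordered pairs of adjacent vertices. *)
Definition matching (M : {set V * V}) :=
  [/\ forall x y, (x, y) \in M -> x != y,
      forall x y, (x, y) \in M -> (y, x) \in M &
      forall x y z, (x, y) \in M -> (x, z) \in M -> y = z].

(** With [M] a matching, [s] consists of full edges and of unmatched vertices. *)
Definition saturated (M : {set V * V}) (s : seq V) :=
  forall x y, (x, y) \in M -> x \in s -> y \in s.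

(** Edges of a matching can be picked greedily: [s] lists the vertices of the
    edges picked so far, and each edge counts twice in [M]. *)
Lemma matching_extend M s : matching M -> saturated M s -> size s < #|M| ->
  exists x y, [/\ (x, y) \in M, x \notin s, y \notin s & saturated M [:: x, y & s]].
Proof.
move=> [M_irr M_sym M_fun] satM lt_s.
have [p pM ps] : exists2 p, p \in M & p.1 \notin s.
  apply/exists_inP; rewrite -[X in is_true X]negbK negb_exists_in.
  apply: contraTN lt_s => /forall_inP sub; rewrite -leqNgt.
  have fst_inj : {in M &, injective fst}.
    by move=> [x y] [x' z] /= xy + eq_x; rewrite -eq_x => /(M_fun _ _ _ xy) ->.
  rewrite -(card_in_imset fst_inj); apply: leq_trans (card_size s).
  apply/subset_leq_card/subsetP=> _ /imsetP[p pM ->].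
  by have := sub p pM; rewrite negbK.
case: p pM ps => x y /= xy xs; exists x, y; split=> //.
  by apply: contra xs; apply: satM; apply: M_sym.
move=> a b ab; rewrite !inE => /or3P[/eqP aE|/eqP aE|/(satM _ _ ab) ->].
- by rewrite aE in ab; rewrite (M_fun _ _ _ ab xy) eqxx orbT.
- by rewrite aE in ab; rewrite (M_fun _ _ _ ab (M_sym _ _ xy)) eqxx.
- by rewrite !orbT.
Qed.

Lemma saturated_edge M x y : matching M -> (x, y) \in M -> saturated M [:: x; y].
Proof.
move=> [_ M_sym M_fun] xy a b ab; rewrite !inE => /orP[]/eqP aE; rewrite aE in ab.
  by rewrite (M_fun _ _ _ ab xy) eqxx orbT.
by rewrite (M_fun _ _ _ ab (M_sym _ _ xy)) eqxx.
Qed.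

Lemma saturated_cat M s1 s2 : saturated M s1 -> saturated M s2 -> saturated M (s1 ++ s2).
Proof.
move=> sat1 sat2 x y xy; rewrite !mem_cat => /orP[/(sat1 _ _ xy)->|/(sat2 _ _ xy)->] //.
by rewrite orbT.
Qed.

Lemma matching_three M : matching M -> 4 < #|M| ->
  exists x1 x2 x3 x4 x5 x6, [/\ uniq [:: x1; x2; x3; x4; x5; x6],
    (x1, x2) \in M, (x3, x4) \in M, (x5, x6) \in M &
    saturated M [:: x1; x2; x3; x4; x5; x6]].
Proof.
move=> mM lt4; have [M_irr _ _] := mM.
have [//||x5 [x6 [x56 _ _ sat6]]] := @matching_extend M [::] mM; first exact: ltn_trans lt4.
have [|x3 [x4 [x34 n3 n4 sat4]]] := matching_extend mM sat6; first exact: ltn_trans lt4.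
have [|x1 [x2 [x12 n1 n2 sat2]]] := matching_extend mM sat4; first exact: lt4.
exists x1, x2, x3, x4, x5, x6; split=> //.
have [[ne12 ne34] ne56] := (M_irr _ _ x12, M_irr _ _ x34, M_irr _ _ x56).
by split_uniq n1; split_uniq n2; split_uniq n3; split_uniq n4; solve_uniq.
Qed.

End Pairs.

(** * Colorings with at most one repeated color on short paths *)

Section OneRepeat.

Variables (V T : finType) (f : V -> V -> T).
Hypothesis fC : forall x y, f x y = f y x.
Hypothesis one_repeat :
  forall s, uniq s -> size s <= 6 -> repeats (path_colors f s) <= 1.

Definition cherry x a b := [&& x != a, x != b, a != b & f x a == f x b].

Lemma cherries_meet x a b y c d :
  cherry x a b -> cherry y c d -> ~~ uniq [:: a; x; b; c; y; d].
Proof.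
move=> /and4P[_ _ _ /eqP ab] /and4P[_ _ _ /eqP cd]; apply/negP=> U.
have := one_repeat U isT; rewrite leqNgt => /negP[].
by rewrite /= !inE (fC a) (fC c) ab cd; count_repeats.
Qed.

Definition cherry_edges : {set V * V} :=
  [set p | [exists z, cherry p.1 p.2 z || cherry p.2 p.1 z]].

Lemma cherry_edges_sym x y : ((x, y) \in cherry_edges) = ((y, x) \in cherry_edges).
Proof. by rewrite !inE /=; apply: eq_existsb => z; rewrite orbC. Qed.

(** All cherries meet a fixed one, so an edge of a cherry either touches this
    fixed cherry or is determined by its center and by
    the other leaf, which lies on the fixed cherry. *)
Lemma card_cherry_edges : #|cherry_edges| <= 12 * #|V|.
Proof.
have [/existsP[x /existsP[a /existsP[b T0]]]|noT] :=
  boolP [exists x, exists a, exists b, cherry x a b]; last first.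
  have {}noT x a b : cherry x a b = false.
    apply: contraNF noT => T0.
    by apply/existsP; exists x; apply/existsP; exists a; apply/existsP; exists b.
  have -> : cherry_edges = set0; last by rewrite cards0.
  by apply/setP=> p; rewrite !inE; apply/existsP=> -[z]; rewrite !noT.
pose W := [set w in [:: x; a; b]].
have leW : #|W| <= 3 by rewrite cardsE; apply: card_size.
pose leaf w := [set p : V * V | [&& p.1 \notin W, p.2 \notin W & cherry p.1 p.2 w]].
pose L := leaf x :|: leaf a :|: leaf b.
pose swap := fun p : V * V => (p.2, p.1).
have card_leaf w : w \in W -> #|leaf w| <= #|V|.
  move=> wW; rewrite -(@card_in_imset _ _ fst); first exact: max_card.
  move=> [y z] [y' z'] /=; rewrite !inE /= => /and3P[yW zW /and4P[yz _ _ /eqP c]].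
  move=> /and3P[_ zW' /and4P[yz' _ _ /eqP c']] yE.
  rewrite -yE in yz' c' *; congr (_, _).
  have [//|zz] := eqVneq z z'.
  have T1 : cherry y z z' by rewrite /cherry yz yz' zz c c' eqxx.
  have /negP[] := cherries_meet T0 T1.
  have /and4P[xa xb ab _] := T0.
  by split_uniq yW; split_uniq zW; split_uniq zW'; solve_uniq.
have sub : cherry_edges \subset (setX W setT :|: setX setT W) :|:
    L :|: swap @: L.
  have far y z w : cherry y z w -> y \notin W -> z \notin W ->
      (y, z) \in L.
    move=> T1 yW zW; have [wW|wW] := boolP (w \in W).
      have : (y, z) \in leaf w by rewrite inE /= yW zW.
      by move: wW; rewrite !inE => /or3P[]/eqP <- ->; rewrite ?orbT.
    have /negP[] := cherries_meet T0 T1.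
    have /and4P[xa xb ab _] := T0; have /and4P[yz yw zw _] := T1.
    by split_uniq yW; split_uniq zW; split_uniq wW; solve_uniq.
  apply/subsetP=> -[y z]; rewrite inE /= => /existsP[w yz].
  have [yW|yW] := boolP (y \in W).
    by apply/setUP; left; apply/setUP; left; apply/setUP; left; rewrite in_setX yW inE.
  have [zW|zW] := boolP (z \in W).
    by apply/setUP; left; apply/setUP; left; apply/setUP; right; rewrite in_setX zW inE.
  case/orP: yz => /far farP.
    by apply/setUP; left; apply/setUP; right; apply: farP.
  by apply/setUP; right; apply/imsetP; exists (z, y); [apply: farP|].
have le_leaves : #|L| <= 3 * #|V|.
  have [xW aW bW] : [/\ x \in W, a \in W & b \in W] by rewrite !inE !eqxx !orbT.
  move: (card_leaf x xW) (card_leaf a aW) (card_leaf b bW).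
  move: (leq_cardsU (leaf x) (leaf a)) (leq_cardsU (leaf x :|: leaf a) (leaf b)).
  by rewrite -/L; lia.
apply: leq_trans (subset_leq_card sub) _.
have leWV : #|W| * #|V| <= 3 * #|V| by rewrite leq_mul2r leW orbT.
have le_swap : #|swap @: L| <= #|L| by apply: leq_imset_card.
have leVW : #|V| * #|W| <= 3 * #|V| by rewrite mulnC.
have le_touch : #|setX W setT :|: setX setT W| <= 3 * #|V| + 3 * #|V|.
  by apply: leq_trans (leq_cardsU _ _) _; rewrite !cardsX cardsT leq_add.
apply: leq_trans (leq_cardsU _ _) _.
apply: leq_trans (leq_add (leq_cardsU _ _) le_swap) _.
by apply: leq_trans (leq_add (leq_add le_touch le_leaves) le_leaves) _; lia.
Qed.

Definition lone_pairs (i : T) : {set V * V} :=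
  [set p | [&& p.1 != p.2, p \notin cherry_edges & f p.1 p.2 == i]].

Lemma matching_lone_pairs i : matching (lone_pairs i).
Proof.
split=> [x y|x y|x y z].
- by rewrite inE => /and3P[].
- by rewrite [in X in X -> _]in_set [in X in _ -> X]in_set /= cherry_edges_sym eq_sym fC.
rewrite !inE /= => /and3P[xy no_cherry /eqP cxy] /and3P[xz _ /eqP cxz].
have [//|yz] := eqVneq y z; case/negP: no_cherry; apply/existsP; exists z.
by rewrite /cherry xy xz yz cxy cxz eqxx.
Qed.

(** Three disjoint edges of one color would repeat it twice on a path with six
    vertices; each edge counts twice in [lone_pairs]. *)
Lemma card_lone_pairs i : #|lone_pairs i| <= 4.
Proof.
rewrite leqNgt; apply/negP=> /(matching_three (matching_lone_pairs i)).
move=> [x1 [x2 [x3 [x4 [x5 [x6 [U]]]]]]]; rewrite !inE /=.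
move=> /and3P[_ _ /eqP c12] /and3P[_ _ /eqP c34] /and3P[_ _ /eqP c56] _.
have := one_repeat U isT; rewrite leqNgt => /negP[].
by rewrite /= !inE c12 c34 c56; count_repeats.
Qed.

Lemma offdiag_split :
  #|V| * #|V|.-1 <= 12 * #|V| + \sum_(i : T) #|lone_pairs i|.
Proof.
rewrite -cardsT -card_offdiag -(cardsID cherry_edges).
apply: leq_add.
  by apply: leq_trans (subset_leq_card (subsetIr _ _)) _; rewrite cardsT card_cherry_edges.
rewrite (card_fibers _ (fun p => f p.1 p.2)); apply: leq_sum => i _.
apply/subset_leq_card/subsetP=> p; rewrite !inE !andbT.
by case/andP=> /andP[-> ->] ->.
Qed.

Lemma half_pairs_le_colors : #|V| * #|V|.-1 <= 12 * #|V| + 4 * #|T|.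
Proof.
apply: leq_trans offdiag_split _; rewrite leq_add2l mulnC -sum_nat_const.
by apply: leq_sum => i _; apply: card_lone_pairs.
Qed.

Definition twin_pairs : {set V * V} :=
  [set p | [&& p.1 != p.2, p \notin cherry_edges &
    [exists q in lone_pairs (f p.1 p.2), (q != p) && (q != (p.2, p.1))]]].

Lemma twin_pairsP x y : reflect
  (exists a b, [/\ (x, y) \in lone_pairs (f x y), (a, b) \in lone_pairs (f x y) &
                  uniq [:: x; y; a; b]])
  ((x, y) \in twin_pairs).
Proof.
have [M_irr M_sym M_fun] := matching_lone_pairs (f x y).
have loneE : ((x, y) \in lone_pairs (f x y)) = (x != y) && ((x, y) \notin cherry_edges).
  by rewrite in_set eqxx andbT.
apply: (iffP idP) => [|[a [b [xy ab U]]]].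
  rewrite in_set /= andbA -loneE => /andP[xy /exists_inP[[a b] ab]].
  rewrite !xpair_eqE !negb_and => /andP[ne1 ne2]; exists a, b; split=> //.
  have [ne_xy ne_ab] := (M_irr _ _ xy, M_irr _ _ ab).
  have xa : x != a.
    by apply: contraTneq ne1 => ax; rewrite -ax in ab *; rewrite eqxx (M_fun _ _ _ ab xy) eqxx.
  have xb : x != b.
    apply: contraTneq ne2 => bx; rewrite -bx in ab *.
    by rewrite eqxx (M_fun _ _ _ (M_sym _ _ ab) xy) eqxx.
  have ya : y != a.
    apply: contraTneq ne2 => ay; rewrite -ay in ab *.
    by rewrite eqxx (M_fun _ _ _ ab (M_sym _ _ xy)) eqxx.
  have yb : y != b.
    apply: contraTneq ne1 => yb; rewrite -yb in ab *.
    by rewrite eqxx (M_fun _ _ _ (M_sym _ _ ab) (M_sym _ _ xy)) eqxx.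
  by solve_uniq.
rewrite in_set /= andbA -loneE xy /=; apply/exists_inP; exists (a, b) => //.
by split_uniq U; rewrite !xpair_eqE !negb_and ![_ == x]eq_sym ![_ == y]eq_sym ne0 ne1 ne2 ne3.
Qed.

Lemma card_lone_pairs_twin i : #|lone_pairs i :\: twin_pairs| <= 2.
Proof.
have [->|[[x y] /setDP[xy xy_twin]]] := set_0Vmem (lone_pairs i :\: twin_pairs).
  by rewrite cards0.
have xyi : f x y = i by move: xy; rewrite in_set => /and3P[_ _ /eqP].
apply: leq_trans (_ : #|[set (x, y); (y, x)]| <= 2); last by rewrite cards2; case: eqP.
apply/subset_leq_card/subsetP=> q /setDP[qi _]; rewrite !inE.
apply: contraR xy_twin; rewrite negb_or => ne.
move: xy; rewrite in_set => /and3P[xy no_cherry _].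
rewrite in_set xy no_cherry /=; apply/exists_inP; exists q => //.
by rewrite xyi.
Qed.

End OneRepeat.

Section OneRepeat7.

Variables (V T : finType) (f : V -> V -> T).
Hypothesis fC : forall x y, f x y = f y x.
Hypothesis one_repeat :
  forall s, uniq s -> size s <= 7 -> repeats (path_colors f s) <= 1.

(** If two pairs of disjoint edges of equal color share the vertex [v], their
    union has maximum degree two and at most seven vertices. Unless it is a
    four-cycle on [v], [w], [a] and [b], it lies on a path with seven
    vertices. *)
Lemma twin_neighbor v w w' a b :
  (v, w) \in lone_pairs f (f v w) -> (a, b) \in lone_pairs f (f v w) ->
  uniq [:: v; w; a; b] -> (v, w') \in twin_pairs f -> w' \in [:: w; a; b].
Proof.
move=> vw ab U /(twin_pairsP fC)[a' [b' [vw' ab' U']]]; apply: contraT => nw'.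
have [M_irr M_sym M_fun] := matching_lone_pairs fC (f v w).
have c1 : f a b = f v w by move: ab; rewrite in_set => /and3P[_ _ /eqP].
have c2 : f a' b' = f v w' by move: ab'; rewrite in_set => /and3P[_ _ /eqP].
have c3 : f v w' != f v w.
  apply: contraNneq nw' => cE; rewrite cE in vw'.
  by rewrite (M_fun _ _ _ vw' vw) inE eqxx.
have bad s : uniq s -> size s <= 7 -> 1 < repeats (path_colors f s) -> false.
  by move=> s_uniq sz_s; rewrite ltnNge one_repeat.
have c4 : f a b != f a' b' by rewrite c1 c2 eq_sym.
have c5 : f a b != f b' a' by rewrite [f b' a']fC.
have e1 : f w' v = f a' b' by rewrite fC c2.
have [e2 e3] : f b' a' = f a' b' /\ f b a = f a b by split; rewrite fC.
have colE := (e1, e2, e3, esym c1); split_uniq U; split_uniq U'; split_uniq nw'.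
have [a'w|a'w] := eqVneq a' w.
  subst a'; have [b'a|b'a] := eqVneq b' a.
    by subst b'; clash bad colE [:: w'; v; w; a; b].
  have [b'b|b'b] := eqVneq b' b.
    by subst b'; clash bad colE [:: w'; v; w; b; a].
  by clash bad colE [:: w'; v; w; b'; a; b].
have [a'a|a'a] := eqVneq a' a.
  subst a'; have [b'w|b'w] := eqVneq b' w.
    by subst b'; clash bad colE [:: w'; v; w; a; b].
  have [b'b|b'b] := eqVneq b' b; first by subst b'; rewrite eqxx in c4.
  by clash bad colE [:: w'; v; w; b; a; b'].
have [a'b|a'b] := eqVneq a' b.
  subst a'; have [b'w|b'w] := eqVneq b' w.
    by subst b'; clash bad colE [:: w'; v; w; b; a].
  have [b'a|b'a] := eqVneq b' a; first by subst b'; rewrite eqxx in c5.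
  by clash bad colE [:: w'; v; w; a; b; b'].
have [b'w|b'w] := eqVneq b' w.
  by subst b'; clash bad colE [:: w'; v; w; a'; a; b].
have [b'a|b'a] := eqVneq b' a.
  by subst b'; clash bad colE [:: w'; v; w; b; a; a'].
have [b'b|b'b] := eqVneq b' b.
  by subst b'; clash bad colE [:: w'; v; w; a; b; a'].
by clash bad colE [:: w'; v; w; a; b; a'; b'].
Qed.

(** By [twin_neighbor], every vertex has at most three neighbors along twin
    pairs. *)
Lemma card_twin_pairs : #|twin_pairs f| <= 3 * #|V|.
Proof.
rewrite (card_fibers _ fst) mulnC -sum_nat_const; apply: leq_sum => v _.
have [->|[[v' w]]] := set_0Vmem [set p in twin_pairs f | p.1 == v].
  by rewrite cards0.
rewrite in_set => /andP[vw /eqP /= vE]; rewrite {v'}vE in vw.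
have [a [b [lone_vw lone_ab U]]] := twin_pairsP fC _ _ vw.
apply: leq_trans (card_size [seq (v, y) | y <- [:: w; a; b]]).
apply/subset_leq_card/subsetP=> -[v' w']; rewrite in_set => /andP[vw' /eqP /= vE].
rewrite vE in vw' *; have := twin_neighbor lone_vw lone_ab U vw'.
by move/(map_f (pair v)).
Qed.

Lemma pairs_le_colors : #|V| * #|V|.-1 <= 15 * #|V| + 2 * #|T|.
Proof.
have one_repeat6 s : uniq s -> size s <= 6 -> repeats (path_colors f s) <= 1.
  by move=> s_uniq /leqW; apply: one_repeat.
apply: leq_trans (offdiag_split fC one_repeat6) _.
have -> : 15 * #|V| + 2 * #|T| = 12 * #|V| + (3 * #|V| + 2 * #|T|) by lia.
rewrite leq_add2l; apply: leq_trans (leq_add card_twin_pairs (leqnn _)).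
rewrite (card_fibers _ (fun p => f p.1 p.2)) mulnC -sum_nat_const -big_split /=.
apply: leq_sum => i _; rewrite -(cardsID (twin_pairs f)) leq_add ?card_lone_pairs_twin //.
apply/subset_leq_card/subsetP=> p /setIP[]; rewrite [in X in X -> _]in_set => /and3P[_ _ pi].
by move=> p_twin; rewrite in_set p_twin.
Qed.

End OneRepeat7.

(** * Proper colorings with at most two repeated colors on paths with eight vertices *)

Section TwoRepeats.

Variables (V T : finType) (f : V -> V -> T).
Hypothesis fC : forall x y, f x y = f y x.
Hypothesis f_proper : forall x y z, x != y -> x != z -> f x y = f x z -> y = z.
Hypothesis two_repeats :
  forall s, uniq s -> size s <= 8 -> repeats (path_colors f s) <= 2.

Definition class (i : T) : {set V * V} := [set p | (p.1 != p.2) && (f p.1 p.2 == i)].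

Definition class_support (i : T) : {set V} := fst @: class i.

(** Each edge counts twice in [class i], so these are the colors with at least
    three edges. *)
Definition big i := 4 < #|class i|.

Lemma in_class i x y : ((x, y) \in class i) = (x != y) && (f x y == i).
Proof. by rewrite in_set. Qed.

Lemma matching_class i : matching (class i).
Proof.
split=> [x y|x y|x y z]; rewrite !in_class.
- by case/andP.
- by rewrite eq_sym fC.
by move=> /andP[xy /eqP cxy] /andP[xz /eqP cxz]; apply: f_proper xy xz _; rewrite cxy cxz.
Qed.

Let bad s : uniq s -> size s <= 8 -> 2 < repeats (path_colors f s) -> false.
Proof. by move=> s_uniq sz_s; rewrite ltnNge two_repeats. Qed.

Lemma class_supportP i x : reflect (exists y, (x, y) \in class i) (x \in class_support i).
Proof.
apply: (iffP imsetP) => [[[a b] ab ->]|[y xy]]; first by exists b.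
by exists (x, y).
Qed.

Lemma big_support i : big i -> 6 <= #|class_support i|.
Proof.
move=> /(matching_three (matching_class i)) [x1 [x2 [x3 [x4 [x5 [x6 [U p12 p34 p56 _]]]]]]].
have [_ M_sym _] := matching_class i.
rewrite -[6]/(size [:: x1; x2; x3; x4; x5; x6]) -(card_uniqP U).
apply/subset_leq_card/subsetP=> x; rewrite !inE.
move=> /or4P[||| /or3P[]] /eqP->; apply/class_supportP.
- by exists x2.
- by exists x1; apply: M_sym.
- by exists x4.
- by exists x3; apply: M_sym.
- by exists x6.
by exists x5; apply: M_sym.
Qed.

(** Four disjoint edges of one color would repeat it three times on a path with
    eight vertices. *)
Lemma card_class_le i : #|class i| <= 4 + 2 * big i.
Proof.
case: (boolP (big i)) => [lt4|]; last by rewrite /big; lia.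
rewrite leqNgt; apply/negP=> lt6.
have mM := matching_class i; have [M_irr _ _] := mM.
have [x1 [x2 [x3 [x4 [x5 [x6 [U p12 p34 p56 sat]]]]]]] := matching_three mM lt4.
have [//|x7 [x8 [p78 n7 n8 _]]] := matching_extend mM sat.
have := M_irr _ _ p78; move: p12 p34 p56 p78; rewrite !in_class.
move=> /andP[_ /eqP c12] /andP[_ /eqP c34] /andP[_ /eqP c56] /andP[_ /eqP c78] ne78.
suff: false by [].
apply: (bad (s := [:: x1; x2; x3; x4; x5; x6; x7; x8])) => //.
  by split_uniq U; split_uniq n7; split_uniq n8; solve_uniq.
by rewrite /= !inE c12 c34 c56 c78; count_repeats.
Qed.

(** Three edges of color [i] already give two repeats on any path through
    them. Adding [p q] and a further edge [u w] of color [j] touches at most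
    eight vertices, and the five edges lie on a common path unless [u w] closes a
    four-cycle with [p q] and two edges of color [i]. As [j] has two further
    edges, one of them does not close this cycle. *)
Lemma no_edge_inside i j p q :
  big i -> big j -> i != j -> p \in class_support i -> q \in class_support i ->
  (p, q) \in class j -> False.
Proof.
move=> big_i big_j ij /class_supportP[p' pp'] /class_supportP[q' qq'] pqj.
have mI := matching_class i; have [I_irr I_sym I_fun] := mI.
have mJ := matching_class j; have [J_irr J_sym J_fun] := mJ.
have ij_ne x y : (x, y) \in class i -> (x, y) \in class j -> false.
  by rewrite !in_class => /andP[_ /eqP->] /andP[_]; rewrite (negPf ij).
have p'q : p' != q by apply/eqP=> p'q; rewrite p'q in pp'; have := ij_ne _ _ pp' pqj.
have pq' : p != q'.
  by apply/eqP=> pq'; rewrite -pq' in qq'; have := ij_ne _ _ (I_sym _ _ qq') pqj.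
have pq := J_irr _ _ pqj; have [ne_p ne_q] := (I_irr _ _ pp', I_irr _ _ qq').
have p'q' : p' != q'.
  apply/eqP=> p'q'; rewrite -p'q' in qq'.
  by rewrite (I_fun _ _ _ (I_sym _ _ pp') (I_sym _ _ qq')) eqxx in pq.
have satI : saturated (class i) [:: p; p'; q; q'].
  exact: saturated_cat (saturated_edge mI pp') (saturated_edge mI qq').
have [//|r [r' [rr' nr nr' _]]] := matching_extend mI satI.
have ne_r := I_irr _ _ rr'; split_uniq nr; split_uniq nr'.
(* Of the two further edges of color [j], one does not close the four-cycle. *)
have [u [w [uwj nu nw far]]] : exists u w, [/\ (u, w) \in class j,
    u \notin [:: p; q], w \notin [:: p; q] &
    ~~ ((u \in [:: p'; q']) && (w \in [:: p'; q']))].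
  have [|u [w [uwj nu nw satJ]]] := matching_extend mJ (saturated_edge mJ pqj).
    exact: ltn_trans big_j.
  have [/andP[u_in w_in]|far] := boolP ((u \in [:: p'; q']) && (w \in [:: p'; q'])).
    have [//|u2 [w2 [uwj2 nu2 nw2 _]]] := matching_extend mJ satJ.
    have uw := J_irr _ _ uwj.
    exists u2, w2; split=> //; first by split_uniq nu2; solve_uniq.
      by split_uniq nw2; solve_uniq.
    apply/negP=> /andP[]; move: u_in w_in uw nu2; rewrite !inE.
    by move=> /orP[]/eqP-> /orP[]/eqP->; rewrite ?eqxx // => _ + /orP[]/eqP u2E;
       rewrite u2E !eqxx ?orbT.
  by exists u, w.
have uw := J_irr _ _ uwj; split_uniq nu; split_uniq nw.
have colI x y : (x, y) \in class i -> f x y = i /\ f y x = i.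
  by rewrite in_class fC => /andP[_ /eqP->].
have colJ x y : (x, y) \in class j -> f x y = j /\ f y x = j.
  by rewrite in_class fC => /andP[_ /eqP->].
have [[e1 e2] [e3 e4]] := (colI _ _ pp', colI _ _ qq').
have [[e5 e6] [e7 e8]] := (colI _ _ rr', colJ _ _ pqj).
have [e9 e10] := colJ _ _ uwj.
have colE := (e1, e2, e3, e4, e5, e6, e7, e8, e9, e10).
have [uE|up1] := eqVneq u p'.
  subst u.
  have [wE|wq1] := eqVneq w q'.
    subst w.
    by rewrite !inE !eqxx ?orbT in far.
  have [wE|wr] := eqVneq w r.
    subst w.
    by clash bad colE [:: q'; q; p; p'; r; r'].
  have [wE|wr1] := eqVneq w r'.
    subst w.
    by clash bad colE [:: q'; q; p; p'; r'; r].
  by clash bad colE [:: q'; q; p; p'; w; r; r'].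
have [uE|uq1] := eqVneq u q'.
  subst u.
  have [wE|wp1] := eqVneq w p'.
    subst w.
    by rewrite !inE !eqxx ?orbT in far.
  have [wE|wr] := eqVneq w r.
    subst w.
    by clash bad colE [:: p'; p; q; q'; r; r'].
  have [wE|wr1] := eqVneq w r'.
    subst w.
    by clash bad colE [:: p'; p; q; q'; r'; r].
  by clash bad colE [:: p'; p; q; q'; w; r; r'].
have [uE|ur] := eqVneq u r.
  subst u.
  have [wE|wp1] := eqVneq w p'.
    subst w.
    by clash bad colE [:: q'; q; p; p'; r; r'].
  have [wE|wq1] := eqVneq w q'.
    subst w.
    by clash bad colE [:: p'; p; q; q'; r; r'].
  have [wE|wr1] := eqVneq w r'.
    subst w.
    by have := ij_ne _ _ rr' uwj.
  by clash bad colE [:: p'; p; q; q'; w; r; r'].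
have [uE|ur1] := eqVneq u r'.
  subst u.
  have [wE|wp1] := eqVneq w p'.
    subst w.
    by clash bad colE [:: q'; q; p; p'; r'; r].
  have [wE|wq1] := eqVneq w q'.
    subst w.
    by clash bad colE [:: p'; p; q; q'; r'; r].
  have [wE|wr] := eqVneq w r.
    subst w.
    by have := ij_ne _ _ (I_sym _ _ rr') uwj.
  by clash bad colE [:: p'; p; q; q'; w; r'; r].
have [wE|wp1] := eqVneq w p'.
  subst w.
  by clash bad colE [:: q'; q; p; p'; u; r; r'].
have [wE|wq1] := eqVneq w q'.
  subst w.
  by clash bad colE [:: p'; p; q; q'; u; r; r'].
have [wE|wr] := eqVneq w r.
  subst w.
  by clash bad colE [:: p'; p; q; q'; u; r; r'].
have [wE|wr1] := eqVneq w r'.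
  subst w.
  by clash bad colE [:: p'; p; q; q'; u; r'; r].
by clash bad colE [:: p'; p; q; q'; r; r'; u; w].
Qed.

(** Two common vertices [p] and [q] would either be joined in one of the two
    colors, or have [j]-neighbors [u] and [w]. By [no_edge_inside] these are not
    among the six vertices of color [i], and then both edges [u p] and [q w] can
    be attached to the edges of color [i]. *)
Lemma big_supports_meet i j p q :
  big i -> big j -> i != j -> p \in class_support i -> q \in class_support i ->
  p \in class_support j -> q \in class_support j -> p = q.
Proof.
move=> big_i big_j ij pi qi pj qj; have [//|pq] := eqVneq p q; exfalso.
have [[p' pp'] [q' qq']] := (class_supportP _ _ pi, class_supportP _ _ qi).
have [[u pu] [w qw]] := (class_supportP _ _ pj, class_supportP _ _ qj).
have mI := matching_class i; have [I_irr I_sym I_fun] := mI.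
have mJ := matching_class j; have [J_irr J_sym J_fun] := mJ.
have pq'_i : p' != q.
  by apply/eqP=> p'q; rewrite p'q in pp'; apply: no_edge_inside big_j big_i _ pj qj pp'; rewrite eq_sym.
have [ui|ui] := boolP (u \in class_support i); first exact: no_edge_inside big_i big_j ij pi ui pu.
have [wi|wi] := boolP (w \in class_support i); first exact: no_edge_inside big_i big_j ij qi wi qw.
have uw : u != w.
  apply/eqP=> uw; rewrite -uw in qw.
  by rewrite (J_fun _ _ _ (J_sym _ _ pu) (J_sym _ _ qw)) eqxx in pq.
have pq' : p != q'.
  by apply/eqP=> E; rewrite -E in qq'; rewrite (I_fun _ _ _ pp' (I_sym _ _ qq')) eqxx in pq'_i.
have p'q' : p' != q'.
  apply/eqP=> p'q'; rewrite -p'q' in qq'.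
  by rewrite (I_fun _ _ _ (I_sym _ _ pp') (I_sym _ _ qq')) eqxx in pq.
have [ne_p ne_q] := (I_irr _ _ pp', I_irr _ _ qq').
have satI : saturated (class i) [:: p; p'; q; q'].
  exact: saturated_cat (saturated_edge mI pp') (saturated_edge mI qq').
have [//|r [r' [rr' nr nr' _]]] := matching_extend mI satI.
have ne_r := I_irr _ _ rr'; split_uniq nr; split_uniq nr'.
have p'i : p' \in class_support i by apply/class_supportP; exists p; apply: I_sym.
have q'i : q' \in class_support i by apply/class_supportP; exists q; apply: I_sym.
have ri : r \in class_support i by apply/class_supportP; exists r'.
have r'i : r' \in class_support i by apply/class_supportP; exists r; apply: I_sym.
have out a b : a \in class_support i -> b \notin class_support i -> a != b.
  by move=> ai bi; apply: contraNneq bi => <-.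
have outU : uniq [:: u; p; p'; q'; q; w; r; r'].
  have [ou ow] := (fun a ai => out a u ai ui, fun a ai => out a w ai wi).
  have := ou _ pi; have := ou _ p'i; have := ou _ qi; have := ou _ q'i.
  have := ou _ ri; have := ou _ r'i; have := ow _ pi; have := ow _ p'i.
  have := ow _ qi; have := ow _ q'i; have := ow _ ri; have := ow _ r'i.
  by move=> *; solve_uniq.
suff: false by []; apply: (bad outU) => //.
move: pp' qq' rr' pu qw; rewrite !in_class.
move=> /andP[_ /eqP c1] /andP[_ /eqP c2] /andP[_ /eqP c3] /andP[_ /eqP c4] /andP[_ /eqP c5].
by rewrite /= !inE [f u p]fC [f q' q]fC c1 c2 c3 c4 c5; count_repeats.
Qed.

(** The vertex sets of the three-edge classes share no pair of vertices, so
    each of these classes takes up fifteen edges. *)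
Lemma card_big : 30 * \sum_(i : T) big i <= #|V| * #|V|.-1.
Proof.
pose D i : {set V * V} := if big i then offdiag (class_support i) else set0.
have D_disj i j : i != j -> [disjoint D i & D j].
  move=> ij; rewrite -setI_eq0 /D.
  case: (boolP (big i)) => big_i; last by rewrite set0I.
  case: (boolP (big j)) => big_j; last by rewrite setI0.
  apply/eqP/setP=> -[x y]; rewrite !inE /=; apply/negP.
  case/andP=> /and3P[xy xi yi] /and3P[_ xj yj].
  by rewrite (big_supports_meet big_i big_j ij xi yi xj yj) eqxx in xy.
have le_union : \sum_i #|D i| <= #|offdiag [set: V]|.
  under eq_bigr do rewrite -sum1_card.
  rewrite -(partition_disjoint_bigcup _ (fun _ => 1) D_disj) sum1_card.
  apply/subset_leq_card/bigcupsP=> i _; rewrite /D; case: ifP => // _.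
    by apply/subsetP=> p; rewrite !inE !andbT => /and3P[].
  exact: sub0set.
rewrite -cardsT -card_offdiag; apply: leq_trans le_union.
rewrite big_distrr /=; apply: leq_sum => i _; rewrite /D; case: (boolP (big i)) => // big_i.
by rewrite card_offdiag; have := big_support big_i; case: #|_| => // k; nia.
Qed.

Lemma proper_pairs_le_colors : 7 * (#|V| * #|V|.-1) <= 30 * #|T|.
Proof.
have := card_big; rewrite -[#|V|]cardsT -card_offdiag.
have : #|offdiag [set: V]| <= 4 * #|T| + 2 * \sum_(i : T) big i.
  rewrite (card_fibers _ (fun p => f p.1 p.2)) mulnC -sum_nat_const big_distrr /=.
  rewrite -big_split /=; apply: leq_sum => i _; apply: leq_trans (card_class_le i).
  by apply/subset_leq_card/subsetP=> p; rewrite !inE !andbT.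
lia.
Qed.

End TwoRepeats.

(** * Packing complete graphs with cliques of fixed size *)

(** The block [j] is the image of [blk j]: two distinct points lie in at most
    one block. *)
Definition packing k (J V : Type) (blk : J -> 'I_k -> V) :=
  (forall j, injective (blk j)) /\
  (forall j j' a b a' b', a <> b -> blk j a = blk j' a' -> blk j b = blk j' b' ->
     j = j').

Definition has_packing k n N := exists blk : 'I_N -> 'I_k -> 'I_n, packing blk.

Lemma has_packingW k n (J V : finType) (blk : J -> 'I_k -> V) N :
  packing blk -> #|V| = n -> N <= #|J| -> has_packing k n N.
Proof.
move=> [blk_inj blk_lin] <- le_N.
exists (fun j a => enum_rank (blk (enum_val (widen_ord le_N j)) a)).
split=> [j a b /enum_rank_inj/blk_inj //|j j' a b a' b' ab].
move=> /enum_rank_inj ea /enum_rank_inj eb.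
have /enum_val_inj eq_j := blk_lin _ _ _ _ _ _ ab ea eb.
by apply: val_inj; apply: (congr1 val eq_j).
Qed.

Lemma has_packing0 k n : has_packing k n 0.
Proof.
have none (j : 'I_0) : False by have := ltn_ord j.
by exists (fun j => False_rect _ (none j)); split=> j; case: (none j).
Qed.

Section Recursion.

Variables (k m t N : nat) (blk0 : 'I_N -> 'I_k -> 'I_(m + t)).
Hypotheses (k_gt1 : 1 < k) (m_gt0 : 0 < m).
Hypothesis m_coprime : forall d, 0 < d < k -> coprime m d.
Hypothesis blk0_packing : packing blk0.

(** The [t] points from [m] on are the extra points, which will be common to all
    groups. *)
Definition thin j :=
  [forall a, forall b, (m <= blk0 j a) && (m <= blk0 j b) ==> (a == b)].

(** Each pair of extra points lies in at most one block. *)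
Lemma card_thin : N - t * t <= #|{: {j | thin j}}|.
Proof.
have [blk_inj blk_lin] := blk0_packing.
pose P j (p : 'I_t * 'I_t) := [exists a, exists b,
  [&& a != b, blk0 j a == rshift m p.1 & blk0 j b == rshift m p.2]].
have thickP (j : {j | ~~ thin j}) : {p | P (val j) p}.
  case: j => j /=; rewrite negb_forall => j_thick; apply: sigW.
  have /existsP[a] := j_thick; rewrite negb_forall => /existsP[b].
  rewrite negb_imply => /andP[/andP[am bm] ab].
  have [am' bm'] : blk0 j a - m < t /\ blk0 j b - m < t.
    by have := (ltn_ord (blk0 j a), ltn_ord (blk0 j b)) => -[/= ??]; lia.
  exists (Ordinal am', Ordinal bm'); apply/existsP; exists a; apply/existsP; exists b.
  by rewrite ab -!val_eqE /= !subnKC ?eqxx.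
have thick_inj : injective (fun j => sval (thickP j)).
  move=> j j' eq_p; apply: val_inj; have := svalP (thickP j'); rewrite -eq_p.
  have := svalP (thickP j); set p := sval _.
  move=> /existsP[a /existsP[b /and3P[/eqP ab /eqP ea /eqP eb]]].
  move=> /existsP[a' /existsP[b' /and3P[_ /eqP ea' /eqP eb']]].
  by apply: (blk_lin _ _ a b a' b' ab); rewrite ?ea ?eb.
have := leq_card _ thick_inj; rewrite card_prod !card_ord.
rewrite !card_sig => le_thick; have := cardC [pred j | thin j]; rewrite card_ord.
have -> : #|[predC [pred j | thin j]]| = #|[pred j | ~~ thin j]| by apply: eq_card.
by move=> eqN; rewrite leq_subLR -[leqLHS]eqN addnC; apply: leq_add.
Qed.

Definition line_point (x y : 'I_m) (a : nat) : 'I_m :=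
  Ordinal (ltn_pmod (x + a * y) m_gt0).

(** A block is a line across all groups, or a thin block copied into the group
    [i] and the extra points. *)
Definition rec_block (j : 'I_m * 'I_m + 'I_k * {j | thin j}) (a : 'I_k) :
    'I_k * 'I_m + 'I_t :=
  match j with
  | inl (x, y) => inl (a, line_point x y a)
  | inr (i, j) => match split (blk0 (val j) a) with
                  | inl u => inl (i, u)
                  | inr z => inr z
                  end
  end.

(** Two values determine a line because the difference of their indices is
    invertible modulo [m]. *)
Lemma line_point_inj x y x' y' (a b : 'I_k) :
  a != b -> line_point x y a = line_point x' y' a ->
  line_point x y b = line_point x' y' b -> (x, y) = (x', y').
Proof.
wlog lt_ab : a b / a < b.
  move=> wl ab ea eb; have [lt_ab|lt_ba|/val_inj/eqP] := ltngtP a b.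
  - exact: wl lt_ab ab ea eb.
  - by apply: wl lt_ba _ eb ea; rewrite eq_sym.
  - by rewrite (negPf ab).
move=> _ /(congr1 val) /= ea /(congr1 val) /= eb.
have eq_y : y = y' :> nat.
  have : (b - a) * y = (b - a) * y' %[mod m].
    apply/eqP; rewrite -(eqn_modDl (x + a * y + (x' + a * y'))); apply/eqP.
    have -> : x + a * y + (x' + a * y') + (b - a) * y = (x + b * y) + (x' + a * y').
      by rewrite mulnBl; have := leq_mul (ltnW lt_ab) (leqnn y); lia.
    have -> : x + a * y + (x' + a * y') + (b - a) * y' = (x' + b * y') + (x + a * y).
      by rewrite mulnBl; have := leq_mul (ltnW lt_ab) (leqnn y'); lia.
    by rewrite -modnDm eb -ea modnDm.
  move/eqP; have co : coprime m (b - a) by apply: m_coprime; have := ltn_ord b; lia.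
  wlog le_y : y y' {ea eb} / y' <= y.
    move=> wl eq_m; have [/wl/(_ eq_m) //|/ltnW/wl le_yy] := leqP y' y.
    by rewrite le_yy // eq_sym.
  rewrite eqn_mod_dvd ?leq_mul // -mulnBr Gauss_dvdr // => m_dvd.
  apply/eqP; rewrite eqn_leq le_y andbT -subn_eq0; apply: contraTT m_dvd.
  rewrite -lt0n => lt0; rewrite gtnNdvd //.
  by apply: leq_ltn_trans (leq_subr _ _) (ltn_ord y).
have {}eq_y := val_inj eq_y; rewrite -eq_y in ea *; congr (_, _); apply: val_inj.
by move/eqP: ea; rewrite eqn_modDr !modn_small ?ltn_ord // => /eqP.
Qed.

Lemma packing_rec_block : packing rec_block.
Proof.
have [blk_inj blk_lin] := blk0_packing.
have rec_inj j : injective (rec_block j).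
  case: j => [[x y]|[i j]] a b /=; first by case.
  move=> eq_ab; apply: (blk_inj (val j)); apply: (can_inj (@splitK m t)).
  by move: eq_ab; case: (split _) => [u|z]; case: (split _) => [u'|z'] // [->].
split=> // j j' a b a' b'.
case: j => [[x y]|[i j]]; case: j' => [[x' y']|[i' j']] /= ab.
- move=> [eqa ea] [eqb eb]; rewrite -eqa in ea; rewrite -eqb in eb.
  congr (inl _); apply: (@line_point_inj _ _ _ _ a b); exact/eqP || exact: val_inj.
- case: (split (blk0 _ a')) => [u|//] [ia _]; case: (split (blk0 _ b')) => [u'|//] [ib _].
  by case: ab; rewrite ia ib.
- move=> ea eb; have a'b' : a' = b'.
    move: ea eb; case: (split (blk0 _ a)) => [u|//] [ia _].
    by case: (split (blk0 _ b)) => [u'|//] [ib _]; rewrite -ia -ib.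
  by case: ab; apply: (rec_inj (inr (i, j))); rewrite /= ea eb a'b'.
have same a0 a1 : match split (blk0 (val j) a0) with inl u => inl (i, u) | inr z => inr z end =
    match split (blk0 (val j') a1) with inl u => inl (i', u) | inr z => inr z end
      :> 'I_k * 'I_m + 'I_t ->
    blk0 (val j) a0 = blk0 (val j') a1 /\ (i = i' \/ m <= blk0 (val j) a0).
  move=> eq_a; have : split (blk0 (val j) a0) = split (blk0 (val j') a1).
    case: (split (blk0 (val j) a0)) eq_a => [u|z]; case: (split (blk0 (val j') a1)) => [u'|z'] //.
      by case=> _ ->.
    by case=> ->.
  move/(can_inj (@splitK m t)) => eq_blk; split=> //; move: eq_a; rewrite -eq_blk.
  by case: splitP => [u _ [->]|z ->]; [left|right; rewrite leq_addr].
move=> /same[ea ga] /same[eb gb]; have ejj := val_inj (blk_lin _ _ _ _ _ _ ab ea eb).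
suff -> : i = i' by rewrite ejj.
case: ga gb => // am [//|bm]; case: ab; apply/eqP.
by have /forallP/(_ a)/forallP/(_ b)/implyP := valP j; apply; rewrite am bm.
Qed.

Lemma has_packing_rec : has_packing k (k * m + t) (m * m + k * (N - t * t)).
Proof.
apply: (has_packingW packing_rec_block).
  by rewrite card_sum card_prod !card_ord.
rewrite card_sum !card_prod !card_ord leq_add2l leq_mul2l.
by rewrite (leq_trans card_thin) ?orbT.
Qed.

End Recursion.

(** Here [c] bounds the weight of the dropped blocks. The surplus [D], multiplied
    by [e.+1] in the recursion, pays for [c] and for counting the [t] extra points
    [e.+1] times. *)
Lemma leave_step_arith e m t N A D c T :
  0 < e -> t <= T -> A * T + c <= D -> e.+1 * e * e.+1 * (T * T) <= c ->
  (m + t) * (m + t) + D <= e.+1 * e * N + A * (m + t) ->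
  (e.+1 * m + t) * (e.+1 * m + t) + D <=
    e.+1 * e * (m * m + e.+1 * (N - t * t)) + A * (e.+1 * m + t).
Proof.
move=> e_gt0 le_t le_D le_c le_m.
have h1 : e.+1 * ((m + t) * (m + t) + D) <= e.+1 * (e.+1 * e * N + A * (m + t)).
  by rewrite leq_mul2l le_m orbT.
have h2 : e * (A * t) + c <= e * D.
  apply: leq_trans (leq_mul (leqnn e) le_D); rewrite mulnDr leq_add ?leq_pmull //.
  by rewrite leq_mul // leq_mul.
have h3 : e.+1 * e * e.+1 * N <= e.+1 * e * e.+1 * (N - t * t) + c.
  apply: leq_trans (leq_add (leqnn _) le_c); rewrite -mulnDr leq_mul //.
  by have := leq_mul le_t le_t; lia.
rewrite !(mulnDr, mulnDl, mulSn, mulnS) in h1 h2 h3 *; nia.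
Qed.

(** The recursion reproduces a linear bound on the uncovered pairs exactly, up to
    a bounded loss at each step; the stronger bound with [n * n + D] on the left
    absorbs this loss. *)
Lemma linear_leave k : 1 < k ->
  exists C, forall n, exists2 N, has_packing k n N & n * n <= k * k.-1 * N + C * n.
Proof.
case: k => // e; rewrite ltnS /= => e_gt0.
pose L := e`!; pose T := e.+1 * L.
have L_gt0 : 0 < L by apply: fact_gt0.
have T_gt0 : 0 < T by rewrite muln_gt0.
have [c le_c] : exists c, e.+1 * e * e.+1 * (T * T) <= c by eexists.
have [n1 n1E] : exists n1, n1 = e.+1 * T.+1 + e.+1 + T by eexists.
have [A AE] : exists A, A = n1 * n1 + c by eexists.
have [D DE] : exists D, D = A * T + c by eexists.
exists A.
have main n : T < n -> exists2 N, has_packing e.+1 n N & n * n + D <= e.+1 * e * N + A * n.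
  elim/ltn_ind: n => n IHn lt_n; have [small|large] := ltnP n n1.
    exists 0; first exact: has_packing0.
    have := leq_mul (leqnn A) lt_n; have := leq_mul (ltnW small) (ltnW small).
    by rewrite mulnS muln0; lia.
  pose q := (n - e.+1) %/ T; pose t := (n - e.+1) %% T; pose m := (L * q).+1.
  have nE : n = e.+1 * m + t.
    have := divn_eq (n - e.+1) T; rewrite -/q -/t /m mulnS mulnA -/T [T * q]mulnC; lia.
  have lt_t : t < T by rewrite ltn_mod.
  have lt_Tm : T < m.
    rewrite ltnNge; apply/negP=> le_m; have := leq_mul (leqnn e.+1) le_m.
    by move: large; rewrite n1E nE mulnS; lia.
  have lt_mn : m + t < n.
    by have := leq_mul e_gt0 (leqnn m); move: nE; rewrite mulSn; lia.
  have [|N [blk blk_packing] leN] := IHn (m + t) lt_mn; first by lia.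
  exists (m * m + e.+1 * (N - t * t)).
    rewrite nE; apply: has_packing_rec blk_packing => //.
    move=> d /andP[d_gt0 lt_de]; have /dvdnP[x LE] : d %| L * q.
      by rewrite dvdn_mulr // dvdn_fact // d_gt0.
    by rewrite /m LE coprime_sym /coprime -addn1 gcdnMDl gcdn1.
  rewrite nE; apply: leave_step_arith (ltnW lt_t) _ le_c leN => //.
  by rewrite DE.
move=> n; have [le_n|/main[N N_packing leN]] := leqP n T; last first.
  by exists N => //; lia.
exists 0; first exact: has_packing0.
have le_n1 : n <= n1 by rewrite n1E; lia.
rewrite muln0 add0n leq_mul // (leq_trans le_n1) // AE.
by rewrite (leq_trans _ (leq_addr _ _)) // leq_pmull // n1E.
Qed.

(** * Coloring along a packing *)

Section BlockColoring.

Variables (n k N : nat) (blk : 'I_N -> 'I_k -> 'I_n).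
Hypothesis blk_packing : packing blk.
Variables (C : finType) (chi : 'I_k -> 'I_k -> C) (P : {set C}).
Hypothesis chiC : forall a b, chi a b = chi b a.
Hypothesis chiP : forall a b, a != b -> chi a b \in P.
Hypothesis chi_proper : forall a b c, a != b -> a != c -> chi a b = chi a c -> b = c.

(** Every block carries its own copy of the pattern [chi]; an uncovered pair
    is its own color. *)
Definition block_color (x y : 'I_n) : {set 'I_n} + 'I_N * C :=
  if [pick u : 'I_N * 'I_k * 'I_k | (blk u.1.1 u.1.2 == x) && (blk u.1.1 u.2 == y)]
  is Some u then inr (u.1.1, chi u.1.2 u.2) else inl [set x; y].

Lemma block_colorE j a b :
  a != b -> block_color (blk j a) (blk j b) = inr (j, chi a b).
Proof.
have [blk_inj blk_lin] := blk_packing; move=> ab; rewrite /block_color.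
case: pickP => [[[j' a'] b'] /= /andP[/eqP ea /eqP eb]|/(_ (j, a, b))]; last first.
  by rewrite /= !eqxx.
have jE := blk_lin _ _ _ _ _ _ (elimN eqP ab) (esym ea) (esym eb).
by rewrite -jE in ea eb *; rewrite (blk_inj _ _ _ ea) (blk_inj _ _ _ eb).
Qed.

Variant block_color_spec x y : {set 'I_n} + 'I_N * C -> Prop :=
| BlockColorIn j a b of a != b & x = blk j a & y = blk j b :
    block_color_spec x y (inr (j, chi a b))
| BlockColorOut of (forall j a b, x = blk j a -> y <> blk j b) :
    block_color_spec x y (inl [set x; y]).

Lemma block_colorP x y : x != y -> block_color_spec x y (block_color x y).
Proof.
move=> xy; rewrite /block_color; case: pickP => [[[j a] b] /= /andP[/eqP ea /eqP eb]|out].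
  by apply: BlockColorIn => //; apply: contraNneq xy => ab; rewrite -ea -eb ab.
by apply: BlockColorOut => j a b xE yE; have := out (j, a, b); rewrite /= xE yE !eqxx.
Qed.

Lemma block_colorC x y : block_color x y = block_color y x.
Proof.
have [->//|xy] := eqVneq x y.
case: (block_colorP xy) => [j a b ab -> ->|out].
  by rewrite block_colorE 1?eq_sym // chiC.
rewrite eq_sym in xy; case: (block_colorP xy) => [j b a _ yE xE|_]; last by rewrite setUC.
by case: (out j a b).
Qed.

Lemma block_color_eq x y z w :
  x != y -> z != w -> block_color x y = block_color z w ->
  [set x; y] = [set z; w] \/
  exists j a b c d, [/\ a != b, c != d, x = blk j a /\ y = blk j b,
                       z = blk j c /\ w = blk j d & chi a b = chi c d].
Proof.
move=> /block_colorP[j a b ab -> ->|_] /block_colorP[j' c d cd -> ->|_] //.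
  by move=> [<- eq_chi]; right; exists j, a, b, c, d.
by case; left.
Qed.

Lemma block_color_proper x y z :
  x != y -> x != z -> block_color x y = block_color x z -> y = z.
Proof.
have [blk_inj _] := blk_packing.
move=> xy xz /(block_color_eq xy xz)[/setP eq_xy|].
  have := eq_xy y; rewrite !inE eqxx orbT => /esym/orP[]/eqP // yx.
  by rewrite yx eqxx in xy.
move=> [j [a [b [c [d [ab cd [xa ->] [xc ->] eq_chi]]]]]].
have ac : a = c by apply: (blk_inj j); rewrite -xa.
rewrite -ac in cd eq_chi; by rewrite (chi_proper ab cd eq_chi).
Qed.

Definition covered : {set {set 'I_n}} :=
  [set blk u.1 @: (u.2 : {set 'I_k}) | u in setX setT [set A : {set 'I_k} | #|A| == 2]].

Lemma card_covered : #|covered| = N * 'C(k, 2).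
Proof.
have [blk_inj blk_lin] := blk_packing.
rewrite card_in_imset ?cardsX ?cardsT ?card_ord ?card_draws ?card_ord //.
move=> [j A] [j' A'] /=; rewrite !inE /= => /cards2P[a [b [ab ->]]] /eqP szA'.
rewrite imsetU1 imset_set1 => eqA.
have [|a' _ ea] := imsetP (_ : blk j a \in blk j' @: A'); first by rewrite -eqA !inE eqxx.
have [|b' _ eb] := imsetP (_ : blk j b \in blk j' @: A'); first by rewrite -eqA !inE eqxx orbT.
have jE := blk_lin _ _ _ _ _ _ (elimN eqP ab) ea eb; rewrite -jE in eqA *; congr (_, _).
by apply: (imset_inj (blk_inj j)); rewrite -eqA imsetU1 imset_set1.
Qed.

Definition block_palette : {set {set 'I_n} + 'I_N * C} :=
  inl @: ([set e : {set 'I_n} | #|e| == 2] :\: covered) :|: inr @: setX setT P.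

Lemma block_color_palette x y : x != y -> block_color x y \in block_palette.
Proof.
move=> xy; case: (block_colorP xy) => [j a b ab _ _|out]; apply/setUP.
  by right; apply: imset_f; rewrite in_setX inE chiP.
left; apply: imset_f; rewrite !inE cards2 xy andbT.
apply/imsetP=> -[[j A]]; rewrite !inE /= => _ /setP eqA.
have := eqA x; have := eqA y; rewrite !inE !eqxx orbT.
by move=> /esym/imsetP[b _ yb] /esym/imsetP[a _ xa]; case: (out j a b).
Qed.

Lemma card_block_palette :
  #|block_palette| + N * 'C(k, 2) <= 'C(n, 2) + N * #|P|.
Proof.
apply: leq_trans (leq_add (leq_cardsU _ _) (leqnn _)) _.
rewrite !card_imset; [|by move=> ?? []|by move=> ?? []].
rewrite cardsX cardsT card_ord addnAC leq_add2r -card_covered.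
have sub : covered \subset [set e : {set 'I_n} | #|e| == 2].
  have [blk_inj _] := blk_packing.
  apply/subsetP=> _ /imsetP[[j A] /= + ->]; rewrite !inE /= => szA.
  by rewrite card_imset.
by rewrite cardsD (setIidPr sub) subnK ?subset_leq_card // card_draws card_ord.
Qed.

Definition block_coord j x := [pick a | blk j a == x].

Lemma block_coordK j : ocancel (block_coord j) (blk j).
Proof. by move=> x; rewrite /block_coord; case: pickP => //= a /eqP. Qed.

Lemma block_coordE j a : block_coord j (blk j a) = Some a.
Proof.
rewrite /block_coord; case: pickP => [b /eqP/(blk_packing.1)->//|/(_ a)].
by rewrite eqxx.
Qed.

(** The vertices of the path [s] in the block [j], in the coordinates of the
    block. *)
Definition trace j (s : seq 'I_n) : seq 'I_k := pmap (block_coord j) s.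

Lemma uniq_trace j s : uniq s -> uniq (trace j s).
Proof. exact: pmap_uniq (@block_coordK j) s. Qed.

Lemma repeats_path_colors_cons (V T : eqType) (f : V -> V -> T) x s :
  repeats (path_colors f s) <= repeats (path_colors f (x :: s)).
Proof. by case: s => //= y s; apply: leq_addl. Qed.

(** A repeated color is repeated inside one block, where consecutive vertices
    of the path stay consecutive. *)
Lemma repeats_trace s : uniq s ->
  repeats (path_colors block_color s) <= \sum_j repeats (path_colors chi (trace j s)).
Proof.
elim: s => //= x [|y s] IHs // /andP[xs s_uniq]; have {}IHs := IHs s_uniq.
rewrite -[repeats (pairmap _ _ _)]/((block_color x y \in path_colors block_color (y :: s))
  + repeats (path_colors block_color (y :: s))).
have drop_x j : repeats (path_colors chi (trace j (y :: s))) <=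
    repeats (path_colors chi (trace j [:: x, y & s])).
  rewrite -[trace j [:: x, y & s]]/(oapp (cons^~ (trace j (y :: s)))
    (trace j (y :: s)) (block_coord j x)).
  by case: (block_coord j x) => [a|] //; apply: repeats_path_colors_cons.
have [rep|_] := boolP (block_color x y \in path_colors block_color (y :: s)); last first.
  rewrite add0n; apply: leq_trans IHs _.
  by apply: leq_sum => j _; apply: drop_x.
have [s1 [s2 [z [w [sE eqc]]]]] := path_colorsP _ _ _ rep.
have zw : z != w.
  move: s_uniq; rewrite sE cat_uniq => /and3P[_ _].
  by rewrite /= inE negb_or => /andP[/andP[]].
have [xz xw] : x != z /\ x != w.
  by split; apply: contraNneq xs => ->; rewrite sE mem_cat !inE eqxx !orbT.
have xy : x != y by apply: contraNneq xs => ->; rewrite mem_head.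
have [/setP/(_ x)|] := block_color_eq xy zw eqc.
  by rewrite !inE eqxx (negPf xz) (negPf xw).
move=> [j [a [b [c [d [ab cd [xa yb] [zc wd] eq_chi]]]]]].
have gain_x : repeats (path_colors chi (trace j (y :: s))) <
    repeats (path_colors chi (trace j [:: x, y & s])).
  have chi_in : chi a b \in path_colors chi (trace j (y :: s)).
    rewrite eq_chi sE /trace pmap_cat /= zc wd !block_coordE /=.
    exact: mem_path_colors_mid.
  by move: chi_in; rewrite /trace /= xa yb !block_coordE /= => ->.
rewrite add1n; apply: leq_ltn_trans IHs _.
rewrite (bigD1 j) //= [X in _ < X](bigD1 j) //= -addSn leq_add //.
by apply: leq_sum => i _; apply: drop_x.
Qed.

Lemma size_trace j s : size (trace j s) = count (fun x => block_coord j x) s.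
Proof. by rewrite size_pmap. Qed.

Lemma count_common j j' s : j != j' -> uniq s ->
  count (fun x => block_coord j x && block_coord j' x) s <= 1.
Proof.
have [_ blk_lin] := blk_packing; move=> jj'; elim: s => //= x s IHs /andP[xs s_uniq].
case x_in: (block_coord j x && block_coord j' x); last exact: IHs.
rewrite add1n ltnS leqNgt -has_count; apply/hasPn=> y ys; apply/negP=> y_in.
have coordP i z : block_coord i z -> exists a, z = blk i a.
  by case Ez: (block_coord i z) => [a|//] _; exists a; have := block_coordK i z; rewrite Ez.
move: x_in y_in => /andP[/coordP[a xa] /coordP[a' xa']] /andP[/coordP[b yb] /coordP[b' yb']].
case/eqP: jj'; apply: (blk_lin _ _ a b a' b'); rewrite -?xa -?yb //.
by move=> ab; case/negP: xs; rewrite xa ab -yb.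
Qed.

Lemma size_trace_le j s : uniq s -> size (trace j s) <= k.
Proof. by move/(uniq_trace j)/card_uniqP=> <-; rewrite -[k in _ <= k]card_ord max_card. Qed.

Lemma size_trace2 j j' s : j != j' -> uniq s ->
  size (trace j s) + size (trace j' s) <= (size s).+1.
Proof.
move=> jj' s_uniq; rewrite !size_trace -count_predUI -addn1.
by rewrite leq_add ?count_size // count_common.
Qed.

(** Inclusion-exclusion for three blocks that pairwise share at most one
    vertex. *)
Lemma size_trace3 j j' i s : j != j' -> j' != i -> i != j -> uniq s ->
  size (trace j s) + size (trace j' s) + size (trace i s) <= size s + 3.
Proof.
move=> jj' j'i ij s_uniq; rewrite !size_trace -count_predUI addnAC.
rewrite -(count_predUI _ (fun x => block_coord i x)) -addnA leq_add ?count_size //.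
have le1 := count_common jj' s_uniq; have le2 := count_common j'i s_uniq.
rewrite eq_sym in ij; have le3 := count_common ij s_uniq.
apply: (@leq_trans (2 + 1)) => //; apply: leq_add; last exact: le1.
apply: leq_trans (leq_add le3 le2).
rewrite -count_predUI; apply: leq_trans (leq_addr _ _); apply: sub_count => x /=.
by rewrite andb_orl.
Qed.

Section FewRepeats.

Hypothesis short_trace : forall t, uniq t -> size t <= 3 -> repeats (path_colors chi t) = 0.
Hypothesis mid_trace : forall t, uniq t -> size t <= 5 -> repeats (path_colors chi t) <= 1.
Hypothesis long_trace : forall t, uniq t -> repeats (path_colors chi t) <= 2.

Variable s : seq 'I_n.
Hypothesis s_uniq : uniq s.

Let h j := repeats (path_colors chi (trace j s)).

Let size_pos j : 0 < h j -> 4 <= size (trace j s).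
Proof.
by apply: contraTT; rewrite -ltnNge -leqNgt => lt4; rewrite /h short_trace ?uniq_trace.
Qed.

Let size_two j : 1 < h j -> 6 <= size (trace j s).
Proof. by apply: contraTT; rewrite -ltnNge -leqNgt => lt6; rewrite mid_trace ?uniq_trace. Qed.

Let sum_le1 : (forall j, h j <= 1) -> \sum_j h j <= #|[set j | 0 < h j]|.
Proof.
move=> le1; rewrite -sum1_card big_mkcond [leqRHS]big_mkcond /=; apply: leq_sum => j _.
by rewrite inE; have := le1 j; case: (h j) => [|[]].
Qed.

(** A repeat needs four vertices in a block; two blocks with four vertices each
    have at least seven vertices. *)
Lemma block_color_repeats6 : k <= 4 -> size s = 6 -> repeats (path_colors block_color s) <= 1.
Proof.
move=> k_le4 sz_s; apply: leq_trans (repeats_trace s_uniq) _.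
apply: leq_trans (sum_le1 _) _ => [j|].
  by apply: mid_trace; rewrite ?uniq_trace // (leq_trans (size_trace_le _ s_uniq)) // (leq_trans k_le4).
rewrite leqNgt; apply/negP=> /card_gt1P[i [j []]]; rewrite !inE => hi hj ij.
have := size_trace2 ij s_uniq; rewrite sz_s.
by have := size_pos hi; have := size_pos hj; lia.
Qed.

(** Two repeats in one block use six vertices, which leaves no room for four
    vertices in another block; three blocks with four vertices each have at least
    nine vertices. *)
Lemma block_color_repeats8 : size s = 8 -> repeats (path_colors block_color s) <= 2.
Proof.
move=> sz_s; apply: leq_trans (repeats_trace s_uniq) _.
have [/existsP[j lt1]|/existsPn all1] := boolP [exists j, 1 < h j].
  rewrite (bigD1 j) //= big1 ?addn0 => [|i ij]; first by apply: long_trace; apply: uniq_trace.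
  apply/eqP; rewrite -leqn0 leqNgt; apply/negP=> hi; have := size_trace2 ij s_uniq.
  by have := size_pos hi; have := size_two lt1; rewrite sz_s; lia.
apply: leq_trans (sum_le1 _) _ => [j|]; first by rewrite leqNgt.
rewrite leqNgt; apply/negP=> /card_gt2P[i [j [l [[]]]]]; rewrite !inE => hi hj hl [ij jl li].
have := size_trace3 ij jl li s_uniq; rewrite sz_s.
by have := size_pos hi; have := size_pos hj; have := size_pos hl; lia.
Qed.

End FewRepeats.

End BlockColoring.

(** * The pattern on a block *)

(** Vertices [2 * g] and [2 * g + 1] form the group [g]. The three edges inside
    the groups get color 6; each of the other colors consists of the two
    disjoint edges of equal parity between two groups. On the first four
    vertices this is the proper coloring with three colors. *)
Definition hexa_color (a b : nat) : nat :=
  if a./2 == b./2 then 6 else (3 - a./2 - b./2).*2 + (odd a (+) odd b).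

Lemma hexa_color_lt a b : hexa_color a b < 7.
Proof.
rewrite /hexa_color; case: eqP => // ne.
suff : 3 - a./2 - b./2 <= 2 by case: (_ (+) _); lia.
by lia.
Qed.

Lemma hexa_colorC a b : hexa_color a b = hexa_color b a.
Proof. by rewrite /hexa_color eq_sym addbC subnAC. Qed.

(** Every path in a block is contained in a Hamiltonian path of the six vertices,
    so it suffices to inspect the 720 orders of these vertices. *)
Lemma hexa_color_perm : all (fun p =>
    [&& repeats (path_colors hexa_color p) <= 2,
        repeats (path_colors hexa_color (take 5 p)) <= 1
      & repeats (path_colors hexa_color (take 3 p)) == 0])
  (permutations (iota 0 6)).
Proof. by []. Qed.

Section Pattern.

Variable k : nat.
Hypothesis k_le6 : k <= 6.

Definition pattern (a b : 'I_k) : 'I_7 := Ordinal (hexa_color_lt a b).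

Lemma path_colors_pattern s :
  repeats (path_colors pattern s) = repeats (path_colors hexa_color (map val s)).
Proof.
rewrite -(repeats_map (h := val)); last by move=> i j _ _; apply: val_inj.
by case: s => //= x s; congr repeats; elim: s x => //= y s IHs x; rewrite IHs.
Qed.

Lemma path_colors_take (V T : eqType) (f : V -> V -> T) s u i : size s <= i ->
  repeats (path_colors f s) <= repeats (path_colors f (take i (s ++ u))).
Proof.
move=> le_si; rewrite take_cat ltnNge le_si /=.
by have [w ->] := path_colors_cat f s (take (i - size s) u); apply: repeats_cat.
Qed.

Lemma pattern_perm (s : seq 'I_k) : uniq s ->
  exists u, map val s ++ u \in permutations (iota 0 6).
Proof.
move=> s_uniq; pose t := map (widen_ord k_le6) s.
have t_uniq : uniq t.
  rewrite map_inj_uniq // => i j eq_ij.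
  by apply: val_inj; apply: (congr1 val eq_ij).
have [|u [tu_uniq sz_tu]] := @uniq_extend _ t 6 t_uniq.
  rewrite card_ord size_map andbT (leq_trans _ k_le6) //.
  by rewrite -(card_uniqP s_uniq) -[leqRHS]card_ord max_card.
exists (map val u); rewrite mem_permutations -val_enum_ord.
have -> : map val s ++ map val u = map val (t ++ u) by rewrite map_cat -map_comp.
apply: perm_map; apply: uniq_perm; rewrite ?enum_uniq //.
have sub : {subset t ++ u <= enum 'I_6} by move=> x _; rewrite mem_enum.
by have [|_] := uniq_min_size tu_uniq sub; first by rewrite size_enum_ord sz_tu.
Qed.

Lemma pattern_repeats (s : seq 'I_k) : uniq s ->
  [/\ repeats (path_colors pattern s) <= 2,
      size s <= 5 -> repeats (path_colors pattern s) <= 1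
    & size s <= 3 -> repeats (path_colors pattern s) = 0].
Proof.
move=> /pattern_perm[u /(allP hexa_color_perm)/and3P[le2 le1 le0]].
rewrite path_colors_pattern -(size_map val); split=> [|le_s|le_s].
- apply: leq_trans le2; have [w ->] := path_colors_cat hexa_color (map val s) u.
  exact: repeats_cat.
- exact: leq_trans (path_colors_take _ _ le_s) le1.
apply/eqP; rewrite -leqn0 -(eqP le0); exact: path_colors_take.
Qed.

Lemma patternC a b : pattern a b = pattern b a.
Proof. by apply: val_inj; apply: hexa_colorC. Qed.

(** Two adjacent edges form a path with three vertices, which repeats no color. *)
Lemma pattern_proper a b c : a != b -> a != c -> pattern a b = pattern a c -> b = c.
Proof.
move=> ab ac eq_c; have [//|bc] := eqVneq b c.
have U : uniq [:: b; a; c] by rewrite eq_sym in ab; solve_uniq.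
have [_ _ /(_ isT)] := pattern_repeats U.
by rewrite /= inE [pattern b a]patternC eq_c eqxx.
Qed.

End Pattern.

(** * Upper bounds *)

Lemma bin2_le n : 2 * 'C(n, 2) <= n * n.
Proof.
rewrite bin2; have := odd_double_half (n * n.-1).
have := leq_mul (leqnn n) (leq_pred n); lia.
Qed.

Lemma ramsey_f_P6_le : exists C, forall n,
  4 * ramsey_f (complete_graph n) (path_graph 6) 4 <= n * n + C * n.
Proof.
have [C leave] := @linear_leave 4 isT; exists C => n.
have [N [blk blk_packing] le_n] := leave n.
pose P := [set i : 'I_7 | 4 <= i].
have chiP (a b : 'I_4) : a != b -> pattern a b \in P.
  by rewrite inE -val_eqE /=; case: a b => [[|[|[|[|//]]]] ?] [[|[|[|[|//]]]] ?].
have szP : #|P| = 3.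
  by rewrite -sum1dep_card big_mkcond /= !big_ord_recl big_ord0.
have rep (t : seq 'I_4) := @pattern_repeats 4 isT t.
have le_r : ramsey_f (complete_graph n) (path_graph 6) 4 <= #|block_palette blk P|.
  apply: (@ramsey_f_le n 5 4 isT _ (block_color blk (@pattern 4))) => [x y|x y|s s_uniq sz_s].
  - by rewrite (block_colorC blk_packing (@patternC 4)).
  - by apply: block_color_palette.
  rewrite -[5]/(4 + 1) leq_add2l.
  by apply: block_color_repeats6 => // t /rep[].
have := card_block_palette blk_packing P; rewrite szP (_ : 'C(4, 2) = 6) //.
by move: le_r le_n (bin2_le n); lia.
Qed.

Lemma ramsey_f_P7_le n :
  2 * ramsey_f (complete_graph n) (path_graph 7) 5 <= n * n.
Proof.
have le_q : 5 <= #|edges (path_graph 7)| by rewrite card_edges_path.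
have [c c_inj] := rainbow_coloring (complete_graph n).
have [_ /(_ _ c (rainbow_Hq le_q c_inj)) le_r] := ramsey_fP (complete_graph n) le_q.
apply: leq_trans (bin2_le n); rewrite leq_mul2l /=; apply: leq_trans le_r _.
rewrite -[n in 'C(n, _)]card_ord -card_draws; apply/subset_leq_card/subsetP.
move=> _ /imset2P[x y _ /[!inE] /= xy ->].
by rewrite cards2 (_ : x != y) // -[_ != _]/(complete_adj x y).
Qed.

Lemma ramsey_f_proper_P8_le : exists C, forall n,
  30 * ramsey_f_proper (complete_graph n) (path_graph 8) 5 <= 7 * (n * n) + C * n.
Proof.
have [C leave] := @linear_leave 6 isT; exists (8 * C) => n.
have [N [blk blk_packing] le_n] := leave n.
have chiP (a b : 'I_6) : a != b -> pattern a b \in [set: 'I_7] by rewrite inE.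
have rep (t : seq 'I_6) := @pattern_repeats 6 isT t.
have le_r : ramsey_f_proper (complete_graph n) (path_graph 8) 5 <= #|block_palette blk [set: 'I_7]|.
  apply: (@ramsey_f_proper_le n 7 5 isT _ (block_color blk (@pattern 6)))
    => [x y|x y|x y z|s s_uniq sz_s].
  - by rewrite (block_colorC blk_packing (@patternC 6)).
  - by apply: block_color_palette.
  - by apply: (block_color_proper blk_packing); apply: pattern_proper.
  rewrite -[7]/(5 + 2) leq_add2l.
  by apply: block_color_repeats8 => // t /rep[].
have := card_block_palette blk_packing [set: 'I_7].
rewrite cardsT card_ord (_ : 'C(6, 2) = 15) //.
by move: le_r le_n (bin2_le n); lia.
Qed.

(** * Lower bounds *)

Lemma ramsey_f_P6_ge n :
  n * n <= 4 * ramsey_f (complete_graph n) (path_graph 6) 4 + 17 * n.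
Proof.
have [n_le5|n_gt5] := leqP n 5; first by have := leq_mul n_le5 (leqnn n); lia.
have [f [fC fP]] := @ramsey_f_attained n 5 4 isT n_gt5.
have one_repeat s : uniq s -> size s <= 6 -> repeats (path_colors f s) <= 1.
  by move=> s_uniq /(fP s s_uniq); lia.
have := half_pairs_le_colors fC one_repeat; rewrite card_option !card_ord.
by case: n {f fC fP one_repeat} n_gt5 => // n _; rewrite mulnS; lia.
Qed.

Lemma ramsey_f_P7_ge n :
  n * n <= 2 * ramsey_f (complete_graph n) (path_graph 7) 5 + 18 * n.
Proof.
have [n_le6|n_gt6] := leqP n 6; first by have := leq_mul n_le6 (leqnn n); lia.
have [f [fC fP]] := @ramsey_f_attained n 6 5 isT n_gt6.
have one_repeat s : uniq s -> size s <= 7 -> repeats (path_colors f s) <= 1.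
  by move=> s_uniq /(fP s s_uniq); lia.
have := pairs_le_colors fC one_repeat; rewrite card_option !card_ord.
by case: n {f fC fP one_repeat} n_gt6 => // n _; rewrite mulnS; lia.
Qed.

Lemma ramsey_f_proper_P8_ge n :
  7 * (n * n) <= 30 * ramsey_f_proper (complete_graph n) (path_graph 8) 5 + 49 * n.
Proof.
have [n_le7|n_gt7] := leqP n 7; first by have := leq_mul n_le7 (leqnn n); lia.
have [f [fC f_proper fP]] := @ramsey_f_proper_attained n 7 5 isT n_gt7.
have two_repeats s : uniq s -> size s <= 8 -> repeats (path_colors f s) <= 2.
  by move=> s_uniq /(fP s s_uniq); lia.
have := proper_pairs_le_colors fC f_proper two_repeats; rewrite card_option !card_ord.
by case: n {f fC f_proper fP two_repeats} n_gt7 => // n _; rewrite mulnS; lia.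
Qed.

(** * Asymptotics *)

Section Asymptotics.

Import Order.TTheory GRing.Theory Num.Theory.
Local Open Scope ring_scope.
Local Open Scope classical_set_scope.

Lemma bigO_of_bounds (R : realType) (r : nat -> nat) (a b C : nat) : (0 < b)%N ->
    (forall n, b * r n <= a * (n * n) + C * n)%N ->
    (forall n, a * (n * n) <= b * r n + C * n)%N ->
  (fun n : nat => (r n)%:R : R) =
    (fun n : nat => a%:R / b%:R * n%:R ^+ 2) +O_\oo (fun n : nat => n%:R : R).
Proof.
move=> b_gt0 r_le r_ge; apply/eqaddOP.
exists C%:R; split; first exact: num_real.
move=> K CK; apply: nearW => n; rewrite -[(_ - _) n]/((r n)%:R - a%:R / b%:R * n%:R ^+ 2).
have b_ge1 : 1 <= b%:R :> R by rewrite ler1n.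
have b_pos : 0 < b%:R :> R by rewrite ltr0n.
have n_ge0 : 0 <= n%:R :> R by rewrite ler0n.
have CKn : C%:R * n%:R <= b%:R * (K * n%:R) :> R.
  have K_ge0 : 0 <= K by apply: le_trans (ltW CK); rewrite ler0n.
  rewrite mulrA ler_wpM2r //; apply: le_trans (ltW CK) _.
  by rewrite ler_peMl.
rewrite (ger0_norm n_ge0) ler_distl -(ler_pM2l b_pos) -[X in _ && X](ler_pM2l b_pos).
rewrite mulrBr mulrDr mulrA [b%:R * (_ / _)]mulrC divfK ?gt_eqF //.
have := r_le n; have := r_ge n.
rewrite -!(ler_nat R) !natrD !natrM -expr2 => ge_n le_n.
by apply/andP; split; lra.
Qed.

End Asymptotics.

Local Open Scope ring_scope.
Local Open Scope classical_set_scope.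
Unset Implicit Arguments.

Theorem theorem1p4 (R : realType) :
  [/\ (fun n : nat => (ramsey_f (complete_graph n) (path_graph 6) 4)%:R : R) =
        (fun n : nat => 1 / 4 * n%:R ^+ 2) +O_\oo (fun n : nat => n%:R : R),
      (fun n : nat => (ramsey_f (complete_graph n) (path_graph 7) 5)%:R : R) =
        (fun n : nat => 1 / 2 * n%:R ^+ 2) +O_\oo (fun n : nat => n%:R : R)
    & (fun n : nat =>
         (ramsey_f_proper (complete_graph n) (path_graph 8) 5)%:R : R) =
        (fun n : nat => 7 / 30 * n%:R ^+ 2) +O_\oo (fun n : nat => n%:R : R)].
Proof.
have weaken C1 C2 (x y n : nat) : (x <= y + C1 * n -> x <= y + (C1 + C2) * n)%N.
  by rewrite mulnDl; lia.
split.
- have [C le_C] := ramsey_f_P6_le.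
  apply: (@bigO_of_bounds R _ 1 4 (17 + C)) => // n; rewrite mul1n.
    by rewrite (addnC 17%N); apply: weaken; apply: le_C.
  by apply: weaken; apply: ramsey_f_P6_ge.
- apply: (@bigO_of_bounds R _ 1 2 18) => // n; rewrite mul1n.
    by rewrite (leq_trans (ramsey_f_P7_le n)) ?leq_addr.
  exact: ramsey_f_P7_ge.
have [C le_C] := ramsey_f_proper_P8_le.
apply: (@bigO_of_bounds R _ 7 30 (49 + C)) => // n.
  by rewrite (addnC 49%N); apply: weaken; apply: le_C.
by apply: weaken; apply: ramsey_f_proper_P8_ge.
Qed.
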